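(* Let $(X,d)$ be a compact metric space without isolated points, of finite non-zero Hausdorff dimension $D$, and assume that the $D$-dimensional Hausdorff measure $\mu_D$ is Ahlfors regular. Let $\nu$ be the measure on $X\times X$ given by $\mathrm d\nu(x,y)=d(x,y)^{-2D}\,\mathrm d\mu_D(x)\,\mathrm d\mu_D(y)$. Then, for each $p\in[1,\infty)$ with $p>D$, $$g\mapsto c_g,\qquad c_g(x,y)=\log|(g^{-1})'|(x)-\log|(g^{-1})'|(y),$$ is a cocycle for the linear isometric action of $\mathrm{M\ddot ob}(X)$ on $L^p(X\times X,\nu)$.
   Context: $\mathrm{M\ddot ob}(X)$ is the group of Möbius self-homeomorphisms of $X$, i.e. homeomorphisms $g:X\to X$ preserving the cross-ratio $(z_1,z_2;z_3,z_4)=\frac{d(z_1,z_3)\,d(z_2,z_4)}{d(z_1,z_4)\,d(z_2,z_3)}$ of all quadruples of distinct points. For $g\in\mathrm{M\ddot ob}(X)$, the metric derivative $|g'|:X\to(0,\infty)$ is the positive continuous function with $d(gx,gy)^2=|g'|(x)\,|g'|(y)\,d(x,y)^2$ for all $x,y\in X$; equivalently $|g'|(x)=\lim_{y\to x}\frac{d(gx,gy)}{d(x,y)}$. The Hausdorff measure is $\mu_D(A)=\lim_{\delta\to0}\inf\{\sum(\operatorname{diam}U_i)^D:(U_i)\ \text{a countable}\ \delta\text{-cover of}\ A\}$. Ahlfors regular means that the $\mu_D$-measure of every ball of radius $r\in[0,\operatorname{diam}X]$ is bounded above and below by positive constant multiples of $r^D$, with constants independent of the ball. The measure $\nu$ is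 well defined since the diagonal is $(\mu_D\times\mu_D)$-negligible, and it is invariant under the diagonal action of $\mathrm{M\ddot ob}(X)$, which acts on the real space $L^p(X\times X,\nu)$ by $(g.F)(x,y)=F(g^{-1}x,g^{-1}y)$. Here $\mathrm{M\ddot ob}(X)$ is regarded as a discrete group; a cocycle is a map $c:\mathrm{M\ddot ob}(X)\to L^p(X\times X,\nu)$ (in particular each $c_g$ lies in $L^p$) with $c_{gh}=g.c_h+c_g$ for all $g,h$. *)

(* Defs.v *)
From HB Require Import structures.
From mathcomp Require Import all_boot all_order all_algebra.
From mathcomp Require Import all_classical all_reals all_analysis.
From mathcomp Require Import measurable_realfun lra.

Set Implicit Arguments.
Unset Strict Implicit.
Unset Printing Implicit Defensive.

Import Order.TTheory GRing.Theory Num.Theory.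
Import numFieldNormedType.Exports.

Local Open Scope classical_set_scope.
Local Open Scope ring_scope.

(* A base point is required by [measurableType]; it carries no information
   beyond [X] being nonempty. *)
#[short(type="pmetricType")]
HB.structure Definition PointedMetric (R : numDomainType) :=
  {M of Metric R M & isPointed M}.

Section hausdorff.
Context {R : realType} {X : pmetricType R}.
Local Open Scope ereal_scope.
Implicit Types (A B : set X) (U : (set X)^nat) (s delta : R).

Definition diam A : \bar R :=
  maxe 0 (ereal_sup [set (mdist z.1 z.2)%:E | z in A `*` A]).

(* The case distinction only matters for [s = 0], where it gives the empty
   set the weight 0 while a singleton has weight [0 `^ 0 = 1]. *)
Definition hausdorff_gauge s A : \bar R :=
  if `[< A = set0 >] then 0 else diam A `^ s.

(* Empty sets are allowed in a cover, so sequences also account for finite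
   covers. *)
Definition delta_cover delta A : set ((set X)^nat) :=
  [set U | (forall i, diam (U i) <= delta%:E) /\ A `<=` \bigcup_i U i].

Definition hausdorff_delta s delta A : \bar R :=
  ereal_inf [set \sum_(i <oo) hausdorff_gauge s (U i) | U in delta_cover delta A].

Definition hausdorff s A : \bar R :=
  lim (hausdorff_delta s delta A @[delta --> 0%R^'+]).

Definition hausdorff_dim A : \bar R :=
  ereal_inf [set s%:E | s in [set s | (0 <= s)%R /\ hausdorff s A = 0]].

Lemma diam_ge0 A : 0 <= diam A. Proof. by rewrite le_max lexx. Qed.

Lemma diam_set0 : diam set0 = 0.
Proof. by rewrite /diam set0X image_set0 ereal_sup0 max_l// leNye. Qed.

Lemma le_diam A x y : A x -> A y -> (mdist x y)%:E <= diam A.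
Proof.
by move=> Ax Ay; rewrite le_max; apply/orP; right; apply: ereal_sup_ubound;
  exists (x, y).
Qed.

Lemma hausdorff_gauge_ge0 s A : 0 <= hausdorff_gauge s A.
Proof. by rewrite /hausdorff_gauge; case: ifP => // _; exact: poweR_ge0. Qed.

Lemma hausdorff_gauge0 s : hausdorff_gauge s set0 = 0.
Proof. by rewrite /hausdorff_gauge; case: asboolP. Qed.

Lemma hausdorff_delta_ge0 s delta A : 0 <= hausdorff_delta s delta A.
Proof.
apply: le_ereal_inf_tmp => _ [U _ <-].
by apply: nneseries_ge0 => *; exact: hausdorff_gauge_ge0.
Qed.

Lemma le_hausdorff_delta s d A B : A `<=` B ->
  hausdorff_delta s d A <= hausdorff_delta s d B.
Proof.
move=> AB; apply/ereal_inf_le_tmp => _ [U [Ud BU] <-]; exists U => //.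
by split => //; exact: subset_trans BU.
Qed.

Lemma hausdorff_delta_anti s A d1 d2 : (d1 <= d2)%R ->
  hausdorff_delta s d2 A <= hausdorff_delta s d1 A.
Proof.
move=> d12; apply/ereal_inf_le_tmp => _ [U [Ud AU] <-]; exists U => //.
by split => // i; rewrite (le_trans (Ud i)) ?lee_fin.
Qed.

Lemma hausdorff_delta0 s d : (0 <= d)%R -> hausdorff_delta s d set0 = 0.
Proof.
move=> d0; apply/eqP; rewrite eq_le hausdorff_delta_ge0 andbT.
apply: ereal_inf_lbound; exists (fun=> set0).
  by split => // i; rewrite diam_set0 lee_fin.
by rewrite eseries0// => *; rewrite hausdorff_gauge0.
Qed.

Lemma hausdorff_delta_sigma_subadditive s d :
  sigma_subadditive (hausdorff_delta s d).
Proof.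
move=> A; have [[i ioo]|] := pselect (exists i, hausdorff_delta s d (A i) = +oo).
  rewrite (eseries_pinfty _ _ ioo) ?leey// => n _.
  by rewrite -ltNye (lt_le_trans _ (hausdorff_delta_ge0 _ _ _)).
rewrite -forallNE => Aoo.
suff add2e (e : {posnum R}) : hausdorff_delta s d (\bigcup_n A n) <=
    \sum_(i <oo) hausdorff_delta s d (A i) + e%:num%:E.
  by apply/lee_addgt0Pr => _/posnumP[].
rewrite (le_trans _ (epsilon_trick _ _ _))//; last first.
  by move=> n; exact: hausdorff_delta_ge0.
pose P n (B : (set X)^nat) := delta_cover d (A n) B /\
  \sum_(k <oo) hausdorff_gauge s (B k) <=
    hausdorff_delta s d (A n) + (e%:num / (2 ^ n.+1)%:R)%:E.
have [G PG] : {G : ((set X)^nat)^nat & forall n, P n (G n)}.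
  apply: (@choice _ _ P) => n; rewrite /P /hausdorff_delta.
  set S := (X in ereal_inf X); move infS : (ereal_inf S) => iS.
  case: iS infS => [r Sr|Soo|Soo].
  - have en1 : (0 < e%:num / (2 ^ n.+1)%:R)%R by [].
    have /(lb_ereal_inf_adherent en1) : ereal_inf S \is a fin_num by rewrite Sr.
    move=> [x [B [mB AnB muBx] xS]].
    by exists B; split => //; rewrite muBx -Sr; exact/ltW.
  - by have := Aoo n; rewrite /hausdorff_delta Soo.
  - suff : lbound S 0 by move/le_ereal_inf_tmp; rewrite Soo.
    move=> /= _ [B [mB AnB] <-]; apply: nneseries_ge0 => *.
    exact: hausdorff_gauge_ge0.
pose mu := hausdorff_gauge s.
have muG_ge0 x : 0 <= (mu \o uncurry G) x by exact: hausdorff_gauge_ge0.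
apply: (@le_trans _ _ (\esum_(i in setT) (mu \o uncurry G) i)).
  rewrite /hausdorff_delta; apply: ereal_inf_lbound => /=.
  have /card_esym/ppcard_eqP[f] := card_nat2.
  exists (uncurry G \o f).
    split => [i|] /=.
      by case: (f i) => a b /=; exact: (PG a).1.1.
    apply: (@subset_trans _  (\bigcup_n \bigcup_k G n k)) => [t [i _]|].
      by move=> /(PG i).1.2[j _ ?]; exists i => //; exists j.
    move=> t [i _ [j _ Bijt]]; exists (f^-1%FUN (i, j)) => //=.
    by rewrite invK ?inE.
  rewrite -(esum_pred_image (mu \o uncurry G) _ xpredT) ?[fun=> _]set_true//.
  by rewrite image_eq.
rewrite (_ : esum _ _ = \sum_(i <oo) \sum_(j <oo ) mu (G i j)); last first.
  pose J : nat -> set (nat * nat) := fun i => [set (i, j) | j in setT].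
  rewrite (_ : setT = \bigcup_k J k); last first.
    by rewrite predeqE => -[a b]; split => // _; exists a => //; exists b.
  rewrite esum_bigcupT /=; last 2 first.
    - apply/trivIsetP => i j _ _ ij.
      rewrite predeqE => -[n m] /=; split => //= -[] [_] _ [<-{n} _].
      by move=> [m' _] [] /esym/eqP; rewrite (negbTE ij).
    - by move=> /= [n m]; exact: hausdorff_gauge_ge0.
  rewrite -(image_id [set: nat]) -fun_true esum_pred_image//; last first.
    by move=> n _; apply: esum_ge0 => x _; exact: muG_ge0.
  apply: eq_eseriesr => /= j _.
  rewrite -(esum_pred_image (mu \o uncurry G) (pair j) predT)//=.
  - by congr esum; rewrite predeqE => -[a b]; split; move=> [i _ <-]; exists i.
  - by move=> n _; exact: (muG_ge0 (j, n)).
  - by move=> ? ? _ _; exact: (@can_inj _ _ _ snd).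
apply: lee_lim.
- apply: is_cvg_nneseries => n *.
  by apply: nneseries_ge0 => m *; exact: (muG_ge0 (n, m)).
- apply: is_cvg_nneseries => n *; apply: adde_ge0 => //.
  exact: hausdorff_delta_ge0.
- by near=> n; apply: lee_sum => i _; exact: (PG i).2.
Unshelve. all: by end_near. Qed.

Lemma hausdorff_is_cvg s A :
  cvg (hausdorff_delta s delta A @[delta --> 0%R^'+]).
Proof.
apply: nonincreasing_at_right_is_cvge; near=> d => x y _ _.
exact: hausdorff_delta_anti.
Unshelve. all: by end_near. Qed.

Lemma le_hausdorff_delta_hausdorff s d A : (0 < d)%R ->
  hausdorff_delta s d A <= hausdorff s A.
Proof.
move=> d0; apply: lime_ge; first exact: hausdorff_is_cvg.
near=> e; apply: hausdorff_delta_anti.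
by near: e; exact: nbhs_right_le.
Unshelve. all: by end_near. Qed.

Lemma hausdorff_le s A (y : \bar R) :
  (forall d, (0 < d)%R -> hausdorff_delta s d A <= y) -> hausdorff s A <= y.
Proof.
move=> h; apply: lime_le; first exact: hausdorff_is_cvg.
by near=> e; apply: h.
Unshelve. all: by end_near. Qed.

Lemma hausdorff_ge0 s A : 0 <= hausdorff s A.
Proof.
apply: le_trans (le_hausdorff_delta_hausdorff s A ltr01).
exact: hausdorff_delta_ge0.
Qed.

Lemma hausdorff0 s : hausdorff s set0 = 0.
Proof.
apply/eqP; rewrite eq_le hausdorff_ge0 andbT; apply: hausdorff_le => d d0.
by rewrite hausdorff_delta0// ltW.
Qed.

Lemma le_hausdorff s : {homo hausdorff s : A B / A `<=` B >-> A <= B}.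
Proof.
move=> A B AB; apply: hausdorff_le => d d0.
apply: le_trans (le_hausdorff_delta_hausdorff s B d0).
exact: le_hausdorff_delta.
Qed.

Lemma hausdorff_sigma_subadditive s : sigma_subadditive (hausdorff s).
Proof.
move=> F; apply: hausdorff_le => d d0.
apply: le_trans (hausdorff_delta_sigma_subadditive s d F) _.
apply: lee_nneseries => [k _ _|k _]; first exact: hausdorff_delta_ge0.
exact: le_hausdorff_delta_hausdorff.
Qed.

HB.instance Definition _ s := isOuterMeasure.Build R X (hausdorff s)
  (hausdorff0 s) (hausdorff_ge0 s) (@le_hausdorff s)
  (@hausdorff_sigma_subadditive s).

End hausdorff.

Section borel.
Context {R : realType} {X : pmetricType R}.
Local Open Scope ereal_scope.
Implicit Types (A B F : set X) (s : R).

Lemma hausdorff_separated s A B (e : R) : (0 < e)%R ->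
  (forall x y, A x -> B y -> (e <= mdist x y)%R) ->
  hausdorff s A + hausdorff s B <= hausdorff s (A `|` B).
Proof.
move=> e0 AB; rewrite /hausdorff -limeD; last 3 first.
- exact: hausdorff_is_cvg.
- exact: hausdorff_is_cvg.
- by apply: ge0_adde_def; rewrite inE; exact: hausdorff_ge0.
apply: lime_le.
  apply: is_cvgeD; [|exact: hausdorff_is_cvg|exact: hausdorff_is_cvg].
  by apply: ge0_adde_def; rewrite inE; exact: hausdorff_ge0.
near=> d.
have d0 : (0 < d)%R by near: d; exact: nbhs_right_gt.
have de : (d < e)%R by near: d; exact: nbhs_right_lt.
apply: le_trans (le_hausdorff_delta_hausdorff s _ d0).
apply: le_ereal_inf_tmp => _ [U [Ud ABU] <-].
pose r C i := if `[< U i `&` C !=set0 >] then U i else set0.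
have rd C i : diam (r C i) <= d%:E.
  by rewrite /r; case: ifP => // _; rewrite diam_set0 lee_fin ltW.
have rC C : C `<=` A `|` B -> C `<=` \bigcup_i r C i.
  move=> CAB x Cx; have [i _ Uix] := ABU _ (CAB _ Cx); exists i => //.
  by rewrite /r; case: asboolP => // -[]; exists x.
have r_content C : C `<=` A `|` B ->
    hausdorff_delta s d C <= \sum_(i <oo) hausdorff_gauge s (r C i).
  by move=> CAB; apply: ereal_inf_lbound; exists (r C) => //; split => //; exact: rC.
apply: le_trans (leeD (r_content A _) (r_content B _)) _.
- exact: subsetUl.
- exact: subsetUr.
rewrite -nneseriesD; last 2 first.
- by move=> *; exact: hausdorff_gauge_ge0.
- by move=> *; exact: hausdorff_gauge_ge0.
apply: lee_nneseries => [i _ _|i _].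
  by apply: adde_ge0; exact: hausdorff_gauge_ge0.
rewrite /r; case: asboolP => [[x [Ux Ax]]|_]; last first.
  rewrite hausdorff_gauge0 add0e; case: ifP => // _.
  by rewrite hausdorff_gauge0 hausdorff_gauge_ge0.
case: asboolP => [[y [Uy By]]|_]; last by rewrite hausdorff_gauge0 adde0.
have := le_trans (le_diam Ux Uy) (Ud i); rewrite lee_fin => /le_lt_trans.
by move=> /(_ _ de); rewrite ltNge (AB _ _ Ax By).
Unshelve. all: by end_near. Qed.

Lemma closed_caratheodory s F : closed F -> (hausdorff s).-caratheodory F.
Proof.
move=> cF; suff HF A : hausdorff s (A `&` F) + hausdorff s (A `&` ~` F) <=
    hausdorff s A by exact: (@le_caratheodory_measurable _ _ (hausdorff s)).
have [->|Aoo] := eqVneq (hausdorff s A) +oo; first exact: leey.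
have Afin : hausdorff s A < +oo by rewrite ltey.
pose B n := A `&` [set x | forall y, F y -> (n.+1%:R^-1 <= mdist x y)%R].
pose D n := B n.+1 `\` B n.
have sepB n : exists2 e : R, (0 < e)%R & forall x y, B n x ->
    (A `\` B n.+1) y -> (e <= mdist x y)%R.
  exists (n.+1%:R^-1 - n.+2%:R^-1)%R.
    by rewrite subr_gt0 ltf_pV2 ?posrE ?ltr_nat// ltr0n.
  move=> x y [_ Bx] [Ay nBy].
  have [z Fz yz] : exists2 z, F z & (mdist y z < n.+2%:R^-1)%R.
    apply: contrapT => h; apply: nBy; split=> // z Fz.
    by rewrite leNgt; apply/negP => yz; apply: h; exists z.
  rewrite lerBlDr (le_trans (Bx _ Fz))// (le_trans (metric_triangle _ y _))//.
  by rewrite lerD2l ltW.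
have BS n : B n `<=` B n.+1.
  move=> x [Ax Bx]; split => // y Fy; apply: le_trans (Bx _ Fy).
  by rewrite lef_pV2 ?posrE ?ler_nat// ltr0n.
have BW m n : (m <= n)%N -> B m `<=` B n.
  elim: n => [|n ih]; first by rewrite leqn0 => /eqP ->.
  by rewrite leq_eqVlt => /predU1P[->//|/ih mn x /mn/BS].
have BA n : B n `<=` A by move=> x [].
have BDS n : hausdorff s (B n) + hausdorff s (D n.+1) <= hausdorff s (B n.+2).
  have [e e0 h] := sepB n.
  apply: le_trans (hausdorff_separated s e0 _) _.
    by move=> x y Bx [By nBy]; apply: h => //; split => //; exact: BA By.
  apply: le_hausdorff => x [|[]//].
  by move=> /BS/BS.
have sumD n : \sum_(0 <= k < n.+1) hausdorff s (D k) <=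
    hausdorff s (B n) + hausdorff s (B n.+1).
  elim: n => [|n ih].
    rewrite big_nat1 -[leLHS]add0e; apply: leeD; first exact: hausdorff_ge0.
    by apply: le_hausdorff => x [].
  rewrite big_nat_recr//=; apply: le_trans (leeD2r _ ih) _.
  by rewrite (addeC (hausdorff s (B n))) -addeA; apply: leeD2l; exact: BDS.
have Doo : \sum_(k <oo) hausdorff s (D k) < +oo.
  apply: (@le_lt_trans _ _ (hausdorff s A + hausdorff s A)); last first.
    exact: lte_add_pinfty.
  apply: lime_le.
    by apply: is_cvg_nneseries => *; exact: hausdorff_ge0.
  near=> n; have n0 : (0 < n)%N by near: n; exact: nbhs_infty_gt.
  rewrite -(prednK n0); apply: le_trans (sumD _) _.
  by apply: leeD; exact: le_hausdorff.
have AFB n : A `&` ~` F `<=` B n `|` \bigcup_(k in ~` `I_n) D k.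
  move=> x [Ax nFx].
  have [m Bmx] : exists m, B m x.
    have /nbhs_ballP[e /= e0 eF] : nbhs x (~` F).
      by apply: open_nbhs_nbhs; split => //; exact: closed_openC.
    have [m me] := ltr_add_invr e0; rewrite add0r in me; exists m; split => //.
    move=> y Fy; rewrite leNgt; apply/negP => xy; apply: (eF y) => //.
    by rewrite ballEmdist/= (lt_trans xy).
  have [Bnx|nBnx] := pselect (B n x); [by left|right].
  elim: m Bmx => [B0|m ih Bm1].
    by exfalso; apply: nBnx; exact: (BW 0%N n).
  have [Bm|nBm] := pselect (B m x); first exact: ih.
  exists m => //= mn; apply: nBnx.
  exact: (BW m.+1 n).
have HAF n : hausdorff s (A `&` F) + hausdorff s (A `&` ~` F) <=
    hausdorff s A + \sum_(n <= k <oo) hausdorff s (D k).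
  apply: le_trans (leeD2l _ (le_outer_measure (hausdorff s) _ _ (AFB n))) _.
  apply: le_trans (leeD2l _ (outer_measureU2 _ _ _)) _.
  rewrite addeA; apply: leeD; last exact: outer_measure_sigma_subadditive_tail.
  apply: le_trans (@hausdorff_separated s _ _ n.+1%:R^-1%R _ _) _ => //.
    by move=> x y [_ Fx] [_ By]; rewrite metric_sym; exact: By.
  by apply: le_hausdorff => x [[]|/BA].
have tail0 : \sum_(n <= k <oo) hausdorff s (D k) @[n --> \oo] --> 0.
  by apply: nneseries_tail_cvg => // k _; exact: hausdorff_ge0.
have : hausdorff s A + \sum_(n <= k <oo) hausdorff s (D k) @[n --> \oo]
    --> hausdorff s A + 0.
  apply: cvgeD => //; last exact: cvg_cst.
  by rewrite fin_num_adde_defl.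
rewrite adde0 => /cvg_lim <-//; apply: lime_ge.
  by apply/cvg_ex; exists (hausdorff s A + 0); apply: cvgeD => //;
    [rewrite fin_num_adde_defl | exact: cvg_cst].
by near=> n; exact: HAF.
Unshelve. all: by end_near. Qed.

End borel.

Definition borel (R : realType) (X : pmetricType R) :=
  g_sigma_algebraType (@open X).

HB.instance Definition _ (R : realType) (X : pmetricType R) :=
  Measurable.on (borel X).

Section hausdorff_measure.
Context {R : realType} {X : pmetricType R}.
Local Open Scope ereal_scope.
Implicit Types (s : R).

Definition hausdorff_measure s : set (borel X) -> \bar R := hausdorff s.

Lemma borel_caratheodory s (A : set (borel X)) :
  measurable A -> (hausdorff s).-caratheodory (A : set X).
Proof.
move: A; apply: smallest_sub.
  split.
  - exact: caratheodory_measurable_set0.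
  - by move=> A mA; rewrite setTD; exact: caratheodory_measurable_setC.
  - by move=> F mF; exact: caratheodory_measurable_bigcup.
move=> A oA; rewrite -(setCK A); apply: caratheodory_measurable_setC.
by apply: closed_caratheodory; exact: open_closedC.
Qed.

Lemma hausdorff_measure0 s : hausdorff_measure s set0 = 0.
Proof. exact: hausdorff0. Qed.

Lemma hausdorff_measure_ge0 s A : 0 <= hausdorff_measure s A.
Proof. exact: hausdorff_ge0. Qed.

Lemma hausdorff_measure_sigma_additive s :
  semi_sigma_additive (hausdorff_measure s).
Proof.
move=> F mF tF mUF.
apply: (@caratheodory_measure_sigma_additive R X (hausdorff s)) => //.
- by move=> i; exact: borel_caratheodory.
- exact: borel_caratheodory.
Qed.

HB.instance Definition _ s := isMeasure.Build _ _ _ (hausdorff_measure s)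
  (hausdorff_measure0 s) (hausdorff_measure_ge0 s)
  (@hausdorff_measure_sigma_additive s).

End hausdorff_measure.

(* At [r = 0] both bounds hold trivially, open balls of radius 0 being empty. *)
Definition ahlfors_regular (R : realType) (X : pmetricType R) (s : R) :=
  exists c C : R, [/\ 0 < c, 0 < C & forall (x : X) (r : R),
    0 <= r -> (r%:E <= diam [set: X])%E ->
    ((c * r `^ s)%:E <= hausdorff_measure s (ball x r) <= (C * r `^ s)%:E)%E].

Section density_measure.
Context {R : realType} {X : pmetricType R}.
Local Open Scope ereal_scope.
Implicit Types (D : R) (A : set (borel X * borel X)).

(* On the diagonal the density is [0 `^ (- (2 * D)) = 0] when [D != 0]. *)
Definition nu D A : \bar R :=
  \int[hausdorff_measure D \x hausdorff_measure D]_(z in A)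
    (mdist (z.1 : X) (z.2 : X) `^ (- (2 * D)))%:E.

Lemma metric_open_ball (x : X) (r : R) : open (ball x r).
Proof.
rewrite openE => y; rewrite ballEmdist/= => xyr.
apply/nbhs_ballP; exists (r - mdist x y)%R => /=; first by rewrite subr_gt0.
move=> z; rewrite !ballEmdist/= ltrBrDl; exact/le_lt_trans/metric_triangle.
Qed.

Lemma compact_ball_cover (e : R) : compact [set: X] -> (0 < e)%R ->
  exists2 S : set X, finite_set S & forall x, exists2 q, S q & ball q e x.
Proof.
rewrite compact_cover => Xcpt e0.
have [||J _ Jcov] := Xcpt X setT (fun q => ball q e).
- by move=> *; exact: metric_open_ball.
- by move=> x _; exists x => //; exact: ballxx.
eexists; first exact: (finite_fset J).
move=> x; have [q qJ qx] := Jcov x I.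
by exists q.
Qed.

Lemma measurable_mdist : compact [set: X] ->
  measurable_fun [set: borel X * borel X]
    (fun z : borel X * borel X => mdist (z.1 : X) (z.2 : X)).
Proof.
move=> Xcpt mT; apply: (measurability _ (RGenInftyO.measurableE R)) => //.
move=> _ [_ [x ->] <-]; rewrite setTI.
have e0 n : (0 < n.+1%:R^-1 :> R)%R by [].
pose s n := sval (cid2 (compact_ball_cover Xcpt (e0 n))).
have [sfin sP] : (forall n, finite_set (s n)) /\
    forall n z, exists2 q, s n q & ball q n.+1%:R^-1 z.
  by split=> n; rewrite /s; case: cid2.
rewrite (_ : _ @^-1` _ = \bigcup_n \bigcup_(q in s n)
    ((ball q n.+1%:R^-1 : set (borel X)) `*`
     (ball q (x - n.+1%:R^-1) : set (borel X)))); last first.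
  apply/seteqP; split => [[a b]|[a b] [n _ [q _ []]]]/=; last first.
    rewrite !ballEmdist/= in_itv/= ltrBrDr => qa qb.
    apply: le_lt_trans (metric_triangle _ q _) _.
    by rewrite addrC metric_sym; apply: le_lt_trans qb; rewrite metric_sym lerD2l metric_sym ltW.
  rewrite in_itv/= => abx.
  have [n nx] : exists n, (n.+1%:R^-1 < (x - mdist a b) / 2)%R.
    by have [|n] := @ltr_add_invr R 0%R ((x - mdist a b) / 2);
      [rewrite divr_gt0// subr_gt0 | rewrite add0r; exists n].
  exists n => //; have [q qs qa] := sP n a; exists q => //; split => //=.
  move: qa; rewrite !ballEmdist/= => qa.
  apply: le_lt_trans (metric_triangle _ a _) _.
  move: nx qa; set u : R := (n.+1%:R^-1)%R; lra.
apply: bigcupT_measurable => n; apply: fin_bigcup_measurable => // q _.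
by apply: measurableX; apply: sub_sigma_algebra; exact: metric_open_ball.
Qed.

Lemma hausdorff_measure_finite D : compact [set: X] -> ahlfors_regular X D ->
  hausdorff_measure D [set: borel X] < +oo.
Proof.
move=> Xcpt [c [C [c0 C0 reg]]].
have [[r r0 rX]|X0] : (exists2 r : R, (0 < r)%R & r%:E <= diam [set: X]) \/
    diam [set: X] = 0.
- have := diam_ge0 [set: X]; rewrite le_eqVlt => /predU1P[<-|]; first by right.
  case: (diam [set: X]) => [r|_|//]; first by left; exists r.
  by left; exists 1%R => //; rewrite leey.
- have [S /finite_seqP[t ->] tP] := compact_ball_cover Xcpt r0.
  rewrite (_ : [set: borel X] = \bigcup_(q in [set` t]) ball q r); last first.
    by apply/seteqP; split => // x _; have [q tq qx] := tP x; exists q.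
  rewrite bigcup_seq; elim/big_ind : _ => [|A B Aoo Boo|q _].
  + by rewrite measure0.
  + by apply: le_lt_trans (outer_measureU2 (hausdorff D) A B) _; exact: lte_add_pinfty.
  + by have /andP[_ /le_lt_trans] := reg q r (ltW r0) rX; apply; exact: ltry.
- apply: (@le_lt_trans _ _ (0 `^ D)); last exact: ltry.
  apply: hausdorff_le => d d0; apply: ereal_inf_lbound.
  exists (fun n => if n is 0%N then setT else set0).
    split => [[|n]|x _]; last by exists 0%N.
    - by rewrite X0 lee_fin ltW.
    - by rewrite diam_set0 lee_fin ltW.
  rewrite nneseries_recl//; last by move=> *; exact: hausdorff_gauge_ge0.
  rewrite eseries_cond/= eseries0 ?adde0.
    rewrite /hausdorff_gauge; case: asboolP => [T0|_]; last by rewrite X0.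
    by have : [set: X] point by []; rewrite T0.
  by case=> // n _ _; rewrite hausdorff_gauge0.
Qed.

Lemma hausdorff_measure_sigma_finite D : compact [set: X] ->
  ahlfors_regular X D -> sigma_finite [set: borel X] (hausdorff_measure D).
Proof.
move=> Xcpt Xreg; exists (fun=> setT); first by rewrite bigcup_const.
by move=> _; split => //; exact: hausdorff_measure_finite.
Qed.

Lemma measurable_nu_density D : compact [set: X] ->
  measurable_fun [set: borel X * borel X]
    (fun z : borel X * borel X =>
      (mdist (z.1 : X) (z.2 : X) `^ (- (2 * D)))%:E).
Proof.
move=> Xcpt; apply/measurable_EFinP.
by apply: (measurableT_comp (measurable_powR _)); exact: measurable_mdist.
Qed.

Variables (D : R).
Hypotheses (X_compact : compact [set: X]) (X_regular : ahlfors_regular X D).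

Let mu : {sigma_finite_measure set (borel X) -> \bar R} :=
  HB.pack (hausdorff_measure D) (Measure_isSigmaFinite.Build _ _ _
    (hausdorff_measure D) (hausdorff_measure_sigma_finite X_compact X_regular)).

Let nuE A : nu D A =
  \int[mu \x mu]_(z in A) (mdist (z.1 : X) (z.2 : X) `^ (- (2 * D)))%:E.
Proof. by []. Qed.

Let nu0 : nu D set0 = 0.
Proof. by rewrite nuE integral_set0. Qed.

Let nu_ge0 A : 0 <= nu D A.
Proof. by rewrite nuE; apply: integral_ge0 => z _; rewrite lee_fin powR_ge0. Qed.

Let nu_sigma_additive : semi_sigma_additive (nu D).
Proof.
move=> F mF tF mUF.
rewrite [X in _ --> X](_ : _ = \sum_(n <oo) nu D (F n)); last first.
  rewrite nuE ge0_integral_bigcup//.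
  - by apply: measurable_funS (measurable_nu_density D X_compact).
  - by move=> z _; rewrite lee_fin powR_ge0.
by apply/cvg_closeP; split; [exact: is_cvg_nneseries|rewrite closeE].
Qed.

(* Compactness makes the density measurable; together with regularity it makes
   the Hausdorff measure finite. Both are needed for [nu D] to be a measure. *)
Definition nu_measure : {measure set (borel X * borel X) -> \bar R} :=
  HB.pack (nu D) (isMeasure.Build _ _ _ (nu D) nu0 nu_ge0 nu_sigma_additive).

End density_measure.

Section moebius.
Context {R : realType} (X : metricType R).

Definition cross_ratio (z1 z2 z3 z4 : X) : R :=
  (mdist z1 z3 * mdist z2 z4) / (mdist z1 z4 * mdist z2 z3).

Record moebius := Moebius {
  moebius_fun :> X -> X;
  moebius_inv : X -> X;
  moebius_funK : cancel moebius_fun moebius_inv;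
  moebius_invK : cancel moebius_inv moebius_fun;
  moebius_continuous : continuous moebius_fun;
  moebius_inv_continuous : continuous moebius_inv;
  moebius_cross_ratio : forall z1 z2 z3 z4, uniq [:: z1; z2; z3; z4] ->
    cross_ratio (moebius_fun z1) (moebius_fun z2) (moebius_fun z3)
      (moebius_fun z4) = cross_ratio z1 z2 z3 z4 }.

Lemma moebiusP (g h : moebius) : g =1 h -> g = h.
Proof.
case: g h => [g gi gK giK gc gic gx] [h hi hK hiK hc hic hx] /= /funext gh.
move: gK giK gc gx; rewrite gh => gK giK gc gx.
have gihi : gi = hi by apply/funext => x; rewrite -[in LHS](hiK x) gK.
move: gK giK gic; rewrite gihi => gK giK gic.
by congr Moebius; exact: Prop_irrelevance.
Qed.

HB.instance Definition _ := gen_eqMixin moebius.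
HB.instance Definition _ := gen_choiceMixin moebius.

Definition moebius_one : moebius.
Proof. by exists id id => //; move=> x; exact: cvg_id. Defined.

Definition moebius_comp (g h : moebius) : moebius.
Proof.
exists (g \o h) (moebius_inv h \o moebius_inv g).
- exact: can_comp (moebius_funK g) (moebius_funK h).
- exact: can_comp (moebius_invK h) (moebius_invK g).
- move=> x; apply: continuous_comp; exact: moebius_continuous.
- move=> x; apply: continuous_comp; exact: moebius_inv_continuous.
- move=> z1 z2 z3 z4 uz /=; rewrite !moebius_cross_ratio//.
  by rewrite -(map_inj_uniq (can_inj (moebius_funK h))) in uz.
Defined.

Definition moebius_opp (g : moebius) : moebius.
Proof.
exists (moebius_inv g) (moebius_fun g).
- exact: moebius_invK.
- exact: moebius_funK.
- exact: moebius_inv_continuous.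
- exact: moebius_continuous.
- move=> z1 z2 z3 z4 uz; rewrite -(@moebius_cross_ratio g).
    by rewrite !moebius_invK.
  by rewrite -(map_inj_uniq (can_inj (moebius_invK g))) in uz.
Defined.

Fact moebius_mulA : associative moebius_comp.
Proof. by move=> f g h; exact: moebiusP. Qed.

Fact moebius_mul1 : left_id moebius_one moebius_comp.
Proof. by move=> f; exact: moebiusP. Qed.

Fact moebius_mulr1 : right_id moebius_one moebius_comp.
Proof. by move=> f; exact: moebiusP. Qed.

Fact moebius_mulV : left_inverse moebius_one moebius_opp moebius_comp.
Proof. by move=> f; apply: moebiusP => x; exact: moebius_funK. Qed.

Fact moebius_mulrV : right_inverse moebius_one moebius_opp moebius_comp.
Proof. by move=> f; apply: moebiusP => x; exact: moebius_invK. Qed.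

HB.instance Definition _ := isGroup.Build moebius moebius_mulA moebius_mul1
  moebius_mulr1 moebius_mulV moebius_mulrV.

Definition is_metric_derivative (g : X -> X) (f : X -> R) :=
  [/\ forall x, 0 < f x, continuous f &
      forall x y, mdist (g x) (g y) ^+ 2 = f x * f y * mdist x y ^+ 2].

(* A default value is returned when there is no metric derivative; there is
   exactly one when [g] is Moebius and [X] is infinite. *)
Definition metric_derivative (g : X -> X) : X -> R :=
  xget (cst 1) [set f | is_metric_derivative g f].

Definition moebius_act (g : moebius) (F : X * X -> R) : X * X -> R :=
  fun z => F ((g^-1)%g z.1, (g^-1)%g z.2).

Definition log_derivative_cocycle (g : moebius) : X * X -> R :=
  fun z => ln (metric_derivative (g^-1)%g z.1)
         - ln (metric_derivative (g^-1)%g z.2).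

End moebius.

Section Lp_action.
Context (G : groupType) d (T : measurableType d) (R : realType).
Variables (m : {measure set T -> \bar R}) (p : \bar R).
Variable act : G -> (T -> R) -> T -> R.

(* Elements of [L^p] are represented by functions in [Lfun m p], and equality
   in [L^p] is equality almost everywhere. *)
Definition Lp_linear_isometric_action :=
  [/\ forall g F, F \in Lfun m p -> act g F \in Lfun m p,
      forall g F H, F \in Lfun m p -> H \in Lfun m p ->
        F = H %[ae m] -> act g F = act g H %[ae m],
      (forall F, F \in Lfun m p -> act 1%g F = F %[ae m]) /\
      (forall g h F, F \in Lfun m p ->
        act (g * h)%g F = act g (act h F) %[ae m]),
      forall g (a : R) F H, F \in Lfun m p -> H \in Lfun m p ->
        act g (a \*: F \+ H) = a \*: act g F \+ act g H %[ae m] &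
      forall g F, F \in Lfun m p ->
        ('N[m]_p[EFin \o act g F] = 'N[m]_p[EFin \o F])%E].

Definition Lp_cocycle (c : G -> T -> R) :=
  (forall g, c g \in Lfun m p) /\
  (forall g h, c (g * h)%g = act g (c h) \+ c g %[ae m]).

End Lp_action.

(* Main.v *)
(** Preserving cross-ratios forces [d(gx,gy)^2 / d(x,y)^2] to split as a product
    [f(x) f(y)], which gives the metric derivative [f = |g'|]; its chain rule is
    the cocycle identity.  An [M]-Lipschitz map increases [mu_D] by a factor
    at most [M^D], so cutting [X] into thin level sets of [|g'|] yields
    [mu_D(gA) <= \int_A |g'|^D dmu_D].  By Tonelli this gives
    [nu(gA) <= nu(A)], and equality follows by applying it to [g^-1].  Finally
    [log |g'|] is Lipschitz, so [|c_g|^p] is at most a constant times [d^p], and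
    Ahlfors regularity bounds its [nu]-integral over the shell
    [e^(-k-1) < d <= e^(-k)] by a constant times [e^(-k(p-D))], which is
    summable as [p > D]. *)

Require Import Defs.
From HB Require Import structures.
From mathcomp Require Import all_boot all_order all_algebra.
From mathcomp Require Import all_classical all_reals all_analysis.
From mathcomp Require Import measurable_realfun lra ring.
Set Implicit Arguments.
Unset Strict Implicit.
Unset Printing Implicit Defensive.

Import Order.TTheory GRing.Theory Num.Theory.
Import numFieldNormedType.Exports.

Local Open Scope classical_set_scope.
Local Open Scope ring_scope.

(** * Continuity of the distance; auxiliary points in a space without isolated points *)

Section metric_continuity.
Context {R : realType} {X : metricType R}.
Implicit Types x y z : X.

Lemma ler_dist_mdist x y z : `|mdist x z - mdist y z| <= mdist x y.
Proof.
have := metric_triangle x y z; have := metric_triangle y x z.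
by rewrite ler_norml (metric_sym y x); lra.
Qed.

Lemma mdistl_continuous y : continuous (fun x => mdist x y).
Proof.
move=> x; apply/cvgrPdist_lt => e e0.
near=> z; apply: le_lt_trans (ler_dist_mdist x z y) _.
by near: z; apply/metricType_numDomainType.nbhs_mdistP; exists e.
Unshelve. all: by end_near. Qed.

Lemma near_neq x y : x != y -> \forall z \near x, z != y.
Proof.
move=> xy; have : \forall z \near x, 0 < mdist z y.
  by apply: (cvgr_gt _ (@mdistl_continuous y x)); rewrite mdist_gt0.
by apply: filterS => z; rewrite mdist_gt0.
Qed.

Hypothesis X_perfect : isolated [set: X] = set0.

Lemma perfect_near_neq x (V : set X) : nbhs x V -> exists2 y, V y & y != x.
Proof.
move=> Vx; apply: contrapT => nV.
have : isolated [set: X] x.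
  split; first by rewrite inE.
  exists V => //; rewrite setIT; apply/seteqP; split => [y Vy|y ->]; last exact: nbhs_singleton.
  by apply: contrapT => /eqP yx; apply: nV; exists y.
by rewrite X_perfect.
Qed.

(** Provides the two auxiliary points that the three-point formula for the metric derivative at [x]
    calls for. *)
Lemma perfect_uniq3 x : exists y z, uniq [:: x; y; z].
Proof.
have [y _ yx] := perfect_near_neq (@filterT _ (nbhs x) _).
have xy : x != y by rewrite eq_sym.
have [z zy zx] := perfect_near_neq (near_neq xy).
by exists y, z; rewrite /= !inE negb_or xy eq_sym zx eq_sym zy.
Qed.

End metric_continuity.

(** * Existence, uniqueness and chain rule of the metric derivative *)

Section metric_derivative.
Context {R : realType} {X : metricType R}.
Hypothesis X_perfect : isolated [set: X] = set0.
Implicit Types (x y z : X) (g h : moebius X).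

Let dratio (g : X -> X) x y : R := mdist (g x) (g y) / mdist x y.

Let dratioC g x y : dratio g x y = dratio g y x.
Proof. by rewrite /dratio metric_sym (metric_sym x). Qed.

Let dratio_gt0 g x y : x != y -> 0 < dratio g x y.
Proof.
move=> xy; rewrite divr_gt0 ?mdist_gt0//.
by rewrite (can_eq (moebius_funK g)).
Qed.

Let dratio_neq0 g x y : x != y -> dratio g x y != 0.
Proof. by move=> xy; rewrite gt_eqF// dratio_gt0. Qed.

Let dratio_exchange g x y z t : uniq [:: x; y; z; t] ->
  dratio g x z * dratio g y t = dratio g x t * dratio g y z.
Proof.
move=> u; have := moebius_cross_ratio g u.
move: u; rewrite /= !inE !negb_or -!andbA => /and5P[xy xz xt yz /andP[yt /andP[zt _]]].
rewrite /cross_ratio /dratio.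
have d0 (a b : X) : a != b -> mdist a b != 0 by move=> ab; rewrite gt_eqF// mdist_gt0.
have gd0 (a b : X) : a != b -> mdist (g a) (g b) != 0.
  by move=> ab; rewrite d0// (can_eq (moebius_funK g)).
have := (d0 _ _ xz, d0 _ _ xt, d0 _ _ yz, d0 _ _ yt, gd0 _ _ xt, gd0 _ _ yz).
move=> [[[[[? ?] ?] ?] ?] ?] /eqP.
rewrite eqr_div ?mulf_neq0// => /eqP e.
apply/eqP; rewrite !mulf_div eqr_div ?mulf_neq0//; apply/eqP.
by rewrite e; ring.
Qed.

(** If [dratio g x y ^+ 2 = f x * f y] off the diagonal with [f] positive, this quotient equals
    [f x]: it is the only candidate for [|g'|(x)]. *)
Let ratio3 g x y z := dratio g x y * dratio g x z / dratio g y z.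

Let ratio3C g x y z : ratio3 g x y z = ratio3 g x z y.
Proof. by rewrite /ratio3 (dratioC g y z) (mulrC (dratio g x y)). Qed.

Let ratio3_swap g x y z t : uniq [:: x; y; z] -> uniq [:: x; y; t] ->
  ratio3 g x y z = ratio3 g x y t.
Proof.
rewrite /= !inE !negb_or -!andbA => /and4P[xy xz yz _] /and4P[_ xt yt _].
have [->//|zt] := eqVneq z t.
rewrite /ratio3; apply/eqP; rewrite eqr_div ?dratio_neq0//.
have := @dratio_exchange g x y z t; rewrite /= !inE !negb_or xy xz xt yz yt zt => /(_ isT) e.
by apply/eqP; rewrite -[LHS]mulrA e [LHS]mulrA.
Qed.

(** The auxiliary points are exchanged one at a time, through the triple [x, y, z']. That triple is
    degenerate only if [y = z'], and then a single exchange is enough. *)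
Let ratio3_indep g x y z y' z' : uniq [:: x; y; z] -> uniq [:: x; y'; z'] ->
  ratio3 g x y z = ratio3 g x y' z'.
Proof.
move=> u u'; move: (u) (u').
rewrite /= !inE !negb_or -!andbA => /and4P[xy xz yz _] /and4P[xy' xz' yz' _].
have [yz'E|yz'N] := eqVneq y z'.
  subst z'; rewrite [RHS]ratio3C; apply: ratio3_swap => //.
  by rewrite /= !inE !negb_or xy xy' eq_sym yz'.
rewrite (@ratio3_swap _ _ _ _ z')//; last first.
  by rewrite /= !inE !negb_or xy xz' yz'N.
rewrite ratio3C [RHS]ratio3C; apply: ratio3_swap => //.
  by rewrite /= !inE !negb_or xy xz' eq_sym yz'N.
by rewrite /= !inE !negb_or xy' xz' eq_sym yz'.
Qed.

(* Preservation of the cross-ratio makes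
   [q(x,y) q(x,z) / q(y,z)], with [q(x,y) = d(gx,gy) / d(x,y)], independent of
   the auxiliary points [y] and [z]. *)
Lemma moebius_is_metric_derivative g : exists f, is_metric_derivative g f.
Proof.
have /(@choice _ _ (fun x yz => uniq [:: x; yz.1; yz.2]))[a aP] :
    forall x, exists yz, uniq [:: x; yz.1; yz.2].
  by move=> x; have [y [z u]] := perfect_uniq3 X_perfect x; exists (y, z).
pose f x := ratio3 g x (a x).1 (a x).2.
have fE x y z : uniq [:: x; y; z] -> f x = ratio3 g x y z.
  by move=> u; apply: ratio3_indep.
exists f; split=> [x|x|x y].
- have := aP x; rewrite /= !inE !negb_or -!andbA => /and4P[xy xz yz _].
  by apply: divr_gt0; [apply: mulr_gt0|]; exact: dratio_gt0.
- have [y [z u]] := perfect_uniq3 X_perfect x; move: (u).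
  rewrite /= !inE !negb_or -!andbA => /and4P[xy xz yz _].
  have cq t : x != t -> {for x, continuous (fun x => dratio g x t)}.
    move=> xt; apply: cvgM.
      apply: (@continuous_comp _ _ _ g (fun u => mdist u (g t))).
        exact: moebius_continuous.
      exact: mdistl_continuous.
    apply: cvgV; first by rewrite gt_eqF// mdist_gt0.
    exact: mdistl_continuous.
  (* The pair [y, z] chosen for [x] also serves every [t] near [x], so near [x] the function [f] is
     one fixed continuous expression. *)
  rewrite /prop_for /continuous_at (fE _ _ _ u).
  apply: (@cvg_trans _ (ratio3 g t y z @[t --> x])).
    apply: near_eq_cvg; near=> t; rewrite (@fE t y z)//.
    rewrite /= !inE negb_or yz !andbT.
    by apply/andP; split; near: t; exact: near_neq.
  by apply: cvgM; [apply: cvgM; exact: cq|exact: cvg_cst].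
- have [->|xy] := eqVneq x y; first by rewrite !mdistxx !expr0n/= mulr0.
  (* With a common third point [z], the factors [dratio g x z] and [dratio g y z] cancel in
     [f x * f y], leaving [dratio g x y ^+ 2]. *)
  have [z [u1 u2]] : exists z, uniq [:: x; y; z] /\ uniq [:: y; x; z].
    have [z zy zx] := perfect_near_neq X_perfect (near_neq xy).
    by exists z; rewrite /= !inE !negb_or xy (eq_sym x z) (eq_sym y z) zx zy eq_sym xy.
  rewrite (fE _ _ _ u1) (fE _ _ _ u2) /ratio3 (dratioC g y x).
  move: u1; rewrite /= !inE !negb_or -!andbA => /and4P[_ xz yz _].
  have -> : mdist (g x) (g y) = dratio g x y * mdist x y.
    by rewrite /dratio divfK// gt_eqF// mdist_gt0.
  have := dratio_neq0 g xz; have := dratio_neq0 g yz.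
  by move=> ? ?; field; apply/andP.
Unshelve. all: by end_near. Qed.

(** Distances determine [f x * f y] for [x != y], hence also [f x ^+ 2], the quotient of
    [(f x * f y) * (f x * f z)] by [f y * f z]. Positivity then gives [f x]. *)
Lemma is_metric_derivative_uniq (g : X -> X) f1 f2 :
  is_metric_derivative g f1 -> is_metric_derivative g f2 -> f1 = f2.
Proof.
move=> [f1p _ f1E] [f2p _ f2E].
have E x y : x != y -> f1 x * f1 y = f2 x * f2 y.
  move=> xy; apply: (@mulIf _ (mdist x y ^+ 2)); last by rewrite -f1E f2E.
  by rewrite expf_neq0// gt_eqF// mdist_gt0.
apply/funext => x; have [y [z]] := perfect_uniq3 X_perfect x.
rewrite /= !inE !negb_or -!andbA => /and4P[xy xz yz _].
have := (f1p x, f1p y, f1p z, f2p x, f2p y, f2p z).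
move=> [[[[[? ?] ?] ?] ?] ?].
apply/eqP; rewrite -(@eqrXn2 _ 2%N) ?ltW//; apply/eqP.
apply: (@mulIf _ (f1 y * f1 z)); first by rewrite gt_eqF// mulr_gt0.
transitivity ((f1 x * f1 y) * (f1 x * f1 z)); first by ring.
by rewrite !E//; ring.
Qed.

Lemma metric_derivativeP g : is_metric_derivative g (metric_derivative g).
Proof.
have [f fP] := moebius_is_metric_derivative g.
exact: (@xgetI _ (cst 1) [set f | is_metric_derivative g f] f).
Qed.

Lemma metric_derivative_eq (g : X -> X) f :
  is_metric_derivative g f -> metric_derivative g = f.
Proof.
move=> gf; apply: (is_metric_derivative_uniq _ gf).
exact: (@xgetI _ (cst 1) [set f | is_metric_derivative g f] f).
Qed.

Lemma metric_derivative_gt0 g x : 0 < metric_derivative g x.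
Proof. by have [] := metric_derivativeP g. Qed.

Lemma metric_derivative_continuous g : continuous (metric_derivative g).
Proof. by have [] := metric_derivativeP g. Qed.

Lemma metric_derivativeE g x y : mdist (g x) (g y) ^+ 2 =
  metric_derivative g x * metric_derivative g y * mdist x y ^+ 2.
Proof. by have [] := metric_derivativeP g. Qed.

(** By uniqueness it suffices that the product on the right is a metric derivative of the
    composite. *)
Lemma metric_derivative_comp g h x : metric_derivative (g * h)%g x =
  metric_derivative g (h x) * metric_derivative h x.
Proof.
rewrite (@metric_derivative_eq (g * h)%g
  (fun x => metric_derivative g (h x) * metric_derivative h x))//.
split => [{}x|{}x|{}x y].
- by rewrite mulr_gt0// metric_derivative_gt0.
- apply: cvgM; last exact: metric_derivative_continuous.
  apply: (@continuous_comp _ _ _ h (metric_derivative g)).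
    exact: moebius_continuous.
  exact: metric_derivative_continuous.
- rewrite -[mdist _ _]/(mdist (g (h x)) (g (h y))) !metric_derivativeE; ring.
Qed.

End metric_derivative.

(** * Bounds on the metric derivative and Lipschitz continuity of its logarithm *)

Lemma ln_lipschitz (R : realType) (e a b : R) : 0 < e -> e <= a -> e <= b ->
  `|ln a - ln b| <= `|a - b| / e.
Proof.
move=> e0; wlog ba : a b / b <= a => [H ea eb|ea eb].
  have [/H|/ltW/H] := leP b a; first exact.
  by rewrite distrC (distrC b); exact.
have [a0 b0] : 0 < a /\ 0 < b by rewrite !(lt_le_trans e0).
rewrite ger0_norm ?subr_ge0 ?ler_ln ?posrE// -ln_div ?posrE//.
(* Reduces the bound to [ln (1 + u) <= u] with [u = (a - b) / b]. *)
rewrite (_ : a / b = 1 + (a - b) / b); last by field; rewrite gt_eqF.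
apply: (@le_trans _ _ ((a - b) / b)).
  by rewrite le_ln1Dx// (lt_le_trans (ltrN10 _))// divr_ge0 ?subr_ge0// ltW.
rewrite ger0_norm ?subr_ge0// ler_wpM2l ?subr_ge0//.
by rewrite lef_pV2 ?posrE.
Qed.

Section metric_derivative_compact.
Context {R : realType} {X : pmetricType R}.
Hypothesis X_perfect : isolated [set: X] = set0.
Hypothesis X_compact : compact [set: X].
Implicit Types (x y z : X) (g h : moebius X).

Lemma metric_derivative_bounds g : exists m M, 0 < m /\
  forall x, m <= metric_derivative g x <= M.
Proof.
have cf : {within [set: X], continuous (metric_derivative g : X -> R)}.
  by apply: continuous_subspaceT; exact: metric_derivative_continuous.
have X0 : [set: X] !=set0 by exists point.
have [a _ am] := compact_EVT_min X0 X_compact cf.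
have [b _ bM] := compact_EVT_max X0 X_compact cf.
exists (metric_derivative g a), (metric_derivative g b).
split; first exact: metric_derivative_gt0.
by move=> x; rewrite am ?inE// bM ?inE.
Qed.

Lemma mdist_moebius_le g x y (M : R) :
  metric_derivative g x <= M -> metric_derivative g y <= M ->
  mdist (g x) (g y) <= M * mdist x y.
Proof.
move=> xM yM.
have M0 : 0 <= M := le_trans (ltW (metric_derivative_gt0 X_perfect g x)) xM.
rewrite -(@ler_pXn2r _ 2%N) ?nnegrE ?mulr_ge0 ?mdist_ge0//.
rewrite metric_derivativeE// exprMn ler_wpM2r ?sqr_ge0// expr2.
by apply: ler_pM => //; rewrite ltW// metric_derivative_gt0.
Qed.

Lemma mdist_moebius_ge g x y (m : R) : 0 <= m ->
  m <= metric_derivative g x -> m <= metric_derivative g y ->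
  m * mdist x y <= mdist (g x) (g y).
Proof.
move=> m0 mx my.
rewrite -(@ler_pXn2r _ 2%N) ?nnegrE ?mulr_ge0 ?mdist_ge0//.
rewrite metric_derivativeE// exprMn ler_wpM2r ?sqr_ge0// expr2.
exact: ler_pM.
Qed.

(* Comparing [x] and [y] with a third point [z] far from both gives
   [|g'|(x) / |g'|(y) = (d(gx,gz) d(y,z) / (d(gy,gz) d(x,z)))^2]. *)
Lemma ln_metric_derivative_lipschitz g : exists L : R, 0 <= L /\
  forall x y, `|ln (metric_derivative g x) - ln (metric_derivative g y)|
    <= L * mdist x y.
Proof.
have [m [M [m0 mM]]] := metric_derivative_bounds g.
have M0 : 0 < M by have /andP[/(lt_le_trans m0)/lt_le_trans] := mM point; apply.
have lmM : ln m <= ln M.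
  by rewrite ler_ln ?posrE//; have /andP[/le_trans] := mM point; apply.
have [q [q0]] := perfect_uniq3 X_perfect (point : X).
rewrite /= !inE !negb_or -!andbA => /and4P[pq _ _ _].
(* Every [x] is at distance at least [2 * e] from [point] or from [q]; a point within [e] of [x] is
   then still at distance at least [e] from the same one. *)
pose e : R := mdist point q / 4.
have e0 : 0 < e by rewrite divr_gt0// mdist_gt0.
have far x : exists z, 2 * e <= mdist x z.
  have [|h] := leP (2 * e) (mdist x point); first by exists point.
  exists q; have := metric_triangle point x q.
  by move: h; rewrite /e (metric_sym point x); lra.
have k0 : 0 <= M / (m * e) + e^-1.
  by rewrite ltW// addr_gt0// ?invr_gt0// divr_gt0// mulr_gt0.
(* The first summand handles pairs closer than [e] by comparison with a far point [z]. The second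
   handles the other pairs, where the oscillation [ln M - ln m] is at most
   [(ln M - ln m) / e * mdist x y]. *)
exists (2 * (M / (m * e) + e^-1) + (ln M - ln m) / e); split.
  by apply: addr_ge0; [exact: mulr_ge0|rewrite divr_ge0 ?subr_ge0// ltW].
move=> x y.
have fp t : 0 < metric_derivative g t := metric_derivative_gt0 X_perfect g t.
have [exy|xye] := leP e (mdist x y).
  apply: (@le_trans _ _ ((ln M - ln m) / e * mdist x y)); last first.
    by rewrite ler_wpM2r ?mdist_ge0// lerDr mulr_ge0.
  apply: (@le_trans _ _ (ln M - ln m)); last first.
    by rewrite -mulrA ler_peMr ?subr_ge0// mulrC ler_pdivlMr// mul1r.
  have lb t : ln m <= ln (metric_derivative g t) <= ln M.
    by rewrite !ler_ln ?posrE//; exact: mM.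
  by have := lb x; have := lb y; rewrite ler_norml; lra.
have [z xz] := far x.
have yz : e <= mdist y z by have := metric_triangle x y z; move: xz xye; lra.
have {}xz : e <= mdist x z by move: xz e0; lra.
(* The logarithm of the defining identity of [|g'|]; the term in [z] alone cancels between [t = x]
   and [t = y]. *)
have E t : e <= mdist t z -> ln (metric_derivative g t) =
    2 * (ln (mdist (g t) (g z)) - ln (mdist t z)) - ln (metric_derivative g z).
  move=> tz; have dtz := lt_le_trans e0 tz.
  have gtz : 0 < mdist (g t) (g z).
    by rewrite mdist_gt0 (can_eq (moebius_funK g)) -(@mdist_gt0 R).
  have := congr1 (@ln R) (metric_derivativeE X_perfect g t z).
  by rewrite !expr2 !lnM ?posrE ?mulr_gt0//; lra.
have ge t : e <= mdist t z -> m * e <= mdist (g t) (g z).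
  move=> tz; apply: (@le_trans _ _ (m * mdist t z)); first by rewrite ler_wpM2l// ltW.
  by apply: mdist_moebius_ge; [exact: ltW|have /andP[]:=mM t|have /andP[]:=mM z].
have h1 : `|ln (mdist (g x) (g z)) - ln (mdist (g y) (g z))| <= M / (m * e) * mdist x y.
  apply: le_trans (ln_lipschitz (mulr_gt0 m0 e0) (ge _ xz) (ge _ yz)) _.
  rewrite mulrAC ler_wpM2r//; first by rewrite invr_ge0 mulr_ge0// ltW.
  apply: le_trans (ler_dist_mdist _ _ _) _.
  by apply: mdist_moebius_le; [have /andP[]:=mM x|have /andP[]:=mM y].
have h2 : `|ln (mdist x z) - ln (mdist y z)| <= e^-1 * mdist x y.
  apply: le_trans (ln_lipschitz e0 xz yz) _.
  by rewrite mulrC ler_wpM2l ?ler_dist_mdist// invr_ge0 ltW.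
have h3 : 0 <= (ln M - ln m) / e * mdist x y.
  by rewrite mulr_ge0 ?mdist_ge0// divr_ge0 ?subr_ge0// ltW.
rewrite (E x xz) (E y yz).
rewrite [leRHS](_ : _ = 2 * (M / (m * e) * mdist x y + e^-1 * mdist x y) +
  (ln M - ln m) / e * mdist x y); last by ring.
move: h1 h2 h3; rewrite !ler_norml.
move: (M / _ * _) (_^-1 * _) (_ / e * _) => a b c.
by move=> /andP[? ?] /andP[? ?] ?; apply/andP; split; lra.
Qed.

End metric_derivative_compact.

(** * Hausdorff measure under Lipschitz maps *)

Section hausdorff_lipschitz.
Context {R : realType} {X : pmetricType R} {Y : pmetricType R}.
Local Open Scope ereal_scope.
Variables (s M : R) (A : set X) (g : X -> Y).
Hypotheses (s_ge0 : (0 <= s)%R) (M_gt0 : (0 < M)%R).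
Hypothesis g_lip :
  forall x y, A x -> A y -> (mdist (g x) (g y) <= M * mdist x y)%R.

Let diam_image U : diam (g @` (U `&` A)) <= M%:E * diam U.
Proof.
rewrite /diam ge_max mule_ge0 ?lee_fin ?diam_ge0 ?(ltW M_gt0)//=.
apply: ge_ereal_sup => _ [[_ _]/= [[x [Ux Ax] <-] [y [Uy Ay] <-]] <-].
apply: (@le_trans _ _ (M * mdist x y)%:E); first by rewrite lee_fin g_lip.
by rewrite EFinM lee_wpmul2l ?lee_fin ?(ltW M_gt0)// le_diam.
Qed.

Let gauge_image U : hausdorff_gauge s (g @` (U `&` A)) <=
  (M `^ s)%:E * hausdorff_gauge s U.
Proof.
rewrite {1}/hausdorff_gauge; case: asboolP => [_|UA].
  by rewrite mule_ge0 ?lee_fin ?powR_ge0 ?hausdorff_gauge_ge0.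
rewrite /hausdorff_gauge; case: asboolP => [U0|_].
  by exfalso; apply: UA; rewrite U0 set0I image_set0.
rewrite -poweR_EFin -poweRM ?lee_fin ?diam_ge0 ?(ltW M_gt0)//.
apply: gt0_ler_poweR => //; rewrite ?in_itv/= ?leey ?diam_ge0//.
by rewrite andbT mule_ge0 ?lee_fin ?diam_ge0 ?(ltW M_gt0).
Qed.

(** A cover of [A] by sets [U i] of diameter at most [d / M] yields the [d]-cover of the image by
    the [g]-images of [U i] cut down to [A], where alone [g] is assumed Lipschitz. *)
Lemma hausdorff_lipschitz :
  hausdorff s (g @` A) <= (M `^ s)%:E * hausdorff s A.
Proof.
have Ms0 : (0 < M `^ s)%R by exact: powR_gt0.
apply: hausdorff_le => d d0.
apply: (@le_trans _ _ ((M `^ s)%:E * hausdorff_delta s (d / M) A)); last first.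
  rewrite lee_wpmul2l ?lee_fin ?(ltW Ms0)//.
  by apply: le_hausdorff_delta_hausdorff; rewrite divr_gt0.
rewrite -lee_pdivrMl//; apply: le_ereal_inf_tmp => _ [U [Ud AU] <-].
rewrite lee_pdivrMl// -nneseriesZl//; last first.
  by move=> *; exact: hausdorff_gauge_ge0.
apply: (@le_trans _ _ (\sum_(i <oo) hausdorff_gauge s (g @` (U i `&` A)))).
  apply: ereal_inf_lbound; exists (fun i => g @` (U i `&` A)) => //; split.
    move=> i; apply: le_trans (diam_image _) _.
    by rewrite -lee_pdivlMl// -EFinM mulrC; exact: Ud.
  by move=> _ [x Ax <-]; have [i _ Uix] := AU _ Ax; exists i => //; exists x.
by apply: lee_nneseries => [i _ _|i _]; [exact: hausdorff_gauge_ge0|].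
Qed.

End hausdorff_lipschitz.

(** * From an inequality of measures to one of integrals *)

Section integral_le_density.
Local Open Scope ereal_scope.
Context d d' (T : measurableType d) (T' : measurableType d') (R : realType).
Variables (m : {measure set T -> \bar R}) (m' : {measure set T' -> \bar R}).
Variables (g : T' -> T) (phi : T' -> \bar R).
Hypotheses (mg : measurable_fun setT g) (mphi : measurable_fun setT phi).
Hypothesis phi_ge0 : forall x, 0 <= phi x.
Hypothesis m_le : forall A, measurable A -> m A <= \int[m']_(x in g @^-1` A) phi x.

Import HBNNSimple.

(** The integral of [h] is a supremum over simple functions [k <= h], and [m_le] applies to each
    level set of [k]. *)
Lemma ge0_integral_le_density (h : T -> \bar R) :
  measurable_fun setT h -> (forall x, 0 <= h x) ->
  \int[m]_x h x <= \int[m']_x (h (g x) * phi x).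
Proof.
move=> mh h0; rewrite ge0_integralTE//; apply: ge_ereal_sup => _ [k /= kh <-].
have mk r : measurable (k @^-1` [set r]).
  by rewrite -[X in measurable X]setTI; exact: measurable_funP.
have mgk r : measurable (g @^-1` (k @^-1` [set r])).
  by rewrite -[X in measurable X]setTI; exact: mg.
apply: (@le_trans _ _ (\int[m']_x ((k (g x))%:E * phi x))); last first.
  apply: ge0_le_integral => //.
  - by move=> x _; rewrite mule_ge0 ?lee_fin.
  - apply: emeasurable_funM => //; apply/measurable_EFinP.
    exact: measurableT_comp.
  - by apply: emeasurable_funM => //; exact: measurableT_comp.
  - by move=> x _; rewrite lee_wpmul2r// kh.
have kE x : (k (g x))%:E * phi x = \sum_(r \in range k)
    (r%:E * ((\1_(g @^-1` (k @^-1` [set r])) x)%:E * phi x)).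
  rewrite fimfunE -fsumEFin// ge0_mule_fsuml; last first.
    by move=> r; rewrite EFinM nnfun_muleindic_ge0.
  by apply: eq_fsbigr => r _; rewrite EFinM muleA.
under eq_integral do rewrite kE.
rewrite ge0_integral_fsum//; last 2 first.
- move=> r; apply: measurable_funeM; apply: emeasurable_funM => //.
  by apply/measurable_EFinP; exact: measurable_indic.
- move=> r x _; rewrite muleA mule_ge0//.
  exact: (nnfun_muleindic_ge0 k r (g x)).
rewrite sintegralE; apply: lee_fsum => // r [y _ <-].
rewrite ge0_integralZl ?lee_fin//; last 2 first.
- apply: emeasurable_funM => //.
  by apply/measurable_EFinP; exact: measurable_indic.
- by move=> x _; rewrite mule_ge0 ?lee_fin.
rewrite lee_wpmul2l ?lee_fin//; apply: le_trans (m_le (mk _)) _.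
rewrite [leLHS]integral_mkcond; apply: ge0_le_integral => //.
- by move=> x _; apply: erestrict_ge0.
- apply/(measurable_restrictT _ _).1 => //; exact: measurable_funTS.
- apply: emeasurable_funM => //.
  by apply/measurable_EFinP; exact: measurable_indic.
- move=> x _; rewrite /restrict indicE; case: ifPn => _; rewrite ?mul1e ?mul0e//.
Qed.

End integral_le_density.

(** * Borel measurability of continuous functions and of the diagonal action *)

Section borel_measurability.
Context {R : realType} {X : pmetricType R}.

Lemma borel_measurable_continuous (f : X -> R) : continuous f ->
  measurable_fun [set: borel X] (f : borel X -> R).
Proof.
move=> /continuousP cf.
apply: (measurability _ (RGenOpens.measurableE R)) => _ [_ [a [b ->]] <-].
rewrite setTI; apply: sub_sigma_algebra; apply: cf.
exact: interval_open.
Qed.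

Lemma borel_measurable_moebius (g : moebius X) :
  measurable_fun [set: borel X] (g : borel X -> borel X).
Proof.
have e : @measurable _ (borel X) = <<s (@open X) >> by [].
refine (measurability _ e _) => _ [A oA <-].
rewrite setTI; apply: sub_sigma_algebra.
by move: A oA; apply/continuousP; exact: moebius_continuous.
Qed.

Definition moebius_diag (g : moebius X) (z : borel X * borel X) :
  borel X * borel X := (g z.1, g z.2).

Lemma measurable_moebius_diag (g : moebius X) :
  measurable_fun [set: borel X * borel X] (moebius_diag g).
Proof.
by apply/measurable_fun_pairP; split;
  apply: measurableT_comp (borel_measurable_moebius g) _.
Qed.

Lemma moebius_diagKV (g : moebius X) :
  cancel (moebius_diag (g^-1)%g) (moebius_diag g).
Proof. by case=> x y; rewrite /moebius_diag/= !moebius_invK. Qed.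

End borel_measurability.

(** * Distortion of the Hausdorff measure by a Möbius map *)

Section conformal_density.
Context {R : realType} {X : pmetricType R}.
Hypothesis X_perfect : isolated [set: X] = set0.
Hypothesis X_compact : compact [set: X].
Variables (D : R) (g : moebius X).
Hypothesis D_gt0 : 0 < D.
Local Open Scope ereal_scope.

Let phi x : \bar R := (metric_derivative g x `^ D)%:E.

Lemma measurable_conformal_density : measurable_fun [set: borel X] phi.
Proof.
apply/measurable_EFinP; apply: (measurableT_comp (measurable_powR _)).
by apply: borel_measurable_continuous; exact: metric_derivative_continuous.
Qed.

(* On the level set [c <= |g'| <= e^t c] the map [g] is Lipschitz of constant
   [e^t c], so both sides agree there up to the factor [e^(t D)]. *)
Lemma hausdorff_measure_le_density (A : set (borel X)) : measurable A ->
  hausdorff_measure D A <= \int[hausdorff_measure D]_(x in g @^-1` A) phi x.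
Proof.
(* It suffices to prove the inequality with the left side multiplied by an arbitrary [r] in []0,
   1[]; this absorbs the loss on each level set. *)
move=> mA; apply/lee_mul01Pr => [|r /andP[r0 r1]]; first exact: measure_ge0.
have [m [M [m0 mM]]] := metric_derivative_bounds X_perfect X_compact g.
have f0 := metric_derivative_gt0 X_perfect g.
have mf : measurable_fun [set: borel X] (metric_derivative g : borel X -> R).
  by apply: borel_measurable_continuous; exact: metric_derivative_continuous.
pose t := (- ln r / D)%R.
have t0 : (0 < t)%R by rewrite divr_gt0// oppr_gt0 ln_lt0// r0.
(* The integer part [k] of [u x] says that [|g'|(x)] lies between [m * expR (k * t)] and [expR t]
   times that value. *)
pose u (x : borel X) := ((ln (metric_derivative g x) - ln m) / t)%R.
have u0 x : (0 <= u x)%R.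
  rewrite divr_ge0// ?(ltW t0)// subr_ge0 ler_ln ?posrE//.
  by have /andP[] := mM x.
have mu_ : measurable_fun setT u.
  apply: measurable_funM => //; apply: measurable_funB => //.
  exact: measurableT_comp.
pose F k := u @^-1` `[k%:R, k.+1%:R[%classic.
have mF k : measurable (F k) by rewrite -[F k]setTI; exact: mu_.
have mgA : measurable (g @^-1` A : set (borel X)).
  by rewrite -[X in measurable X]setTI; exact: borel_measurable_moebius.
pose B k : set (borel X) := g @^-1` A `&` F k.
have mB k : measurable (B k) by exact: measurableI.
have FT : \bigcup_k F k = setT.
  apply/seteqP; split => // x _; exists (Num.truncn (u x)) => //.
  by rewrite /F /= in_itv/= truncn_itv.
have BE : \bigcup_k B k = g @^-1` A by rewrite -setI_bigcupr FT setIT.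
have tB : trivIset setT B.
  apply/trivIsetP => i j _ _ ij; apply/seteqP; split => // x [[_ +] [_ +]].
  rewrite /F /= !in_itv/= => /truncn_def xi /truncn_def xj.
  by move: ij; rewrite -xi -xj eqxx.
have AE : A `<=` \bigcup_k g @` B k.
  move=> y Ay; have : (g @^-1` A) (moebius_inv g y) by rewrite /= moebius_invK.
  by rewrite -BE => -[k _ Bk]; exists k => //; exists (moebius_inv g y) => //; exact: moebius_invK.
rewrite -BE ge0_integral_bigcup//; last 2 first.
- by apply: measurable_funTS; exact: measurable_conformal_density.
- by move=> x _; rewrite lee_fin powR_ge0.
(* Countable subadditivity of the outer measure [hausdorff D] treats the images of the [B k] without
   discussing their measurability. *)
apply: (@le_trans _ _ (r%:E * \sum_(k <oo) hausdorff D (g @` B k))).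
  rewrite lee_wpmul2l ?lee_fin ?(ltW r0)//.
  apply: le_trans (le_outer_measure (hausdorff D) _ _ AE) _.
  exact: outer_measure_sigma_subadditive.
rewrite -nneseriesZl; last by move=> *; exact: hausdorff_ge0.
apply: lee_nneseries => [k _ _|k _].
  by rewrite mule_ge0 ?lee_fin ?(ltW r0) ?hausdorff_ge0.
pose c := (m * expR (k%:R * t))%R.
have c0 : (0 < c)%R by rewrite mulr_gt0 ?expR_gt0.
have fc x : B k x -> (c <= metric_derivative g x <= c * expR t)%R.
  move=> [_]; rewrite /F /= in_itv/= /u ler_pdivlMr// ltr_pdivrMr//.
  rewrite -[metric_derivative g x]lnK ?posrE// => /andP[h1 h2].
  rewrite /c -[m]lnK ?posrE// -!expRD !ler_expR; rewrite lnK ?posrE// in h1 h2 *.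
  by move: h1 h2; rewrite -[k.+1%:R]natr1; lra.
apply: (@le_trans _ _ (r%:E * (((c * expR t) `^ D)%:E * hausdorff D (B k)))).
  rewrite lee_wpmul2l ?lee_fin ?(ltW r0)//.
  apply: hausdorff_lipschitz; rewrite ?(ltW D_gt0) ?mulr_gt0 ?expR_gt0//.
  move=> x y /fc/andP[_ xM] /fc/andP[_ yM].
  exact: mdist_moebius_le.
rewrite muleA -EFinM powRM ?(ltW c0) ?expR_ge0// mulrCA.
have -> : (r * expR t `^ D = 1)%R.
  rewrite -expRM /t divfK ?gt_eqF// expRN lnK ?posrE// divff ?gt_eqF//.
rewrite mulr1 -[hausdorff D (B k)]/(hausdorff_measure D (B k)).
rewrite -integral_cst//; apply: ge0_le_integral => //.
- by move=> x _; rewrite lee_fin powR_ge0.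
- by apply: measurable_funTS; exact: measurable_conformal_density.
- move=> x /fc/andP[cx _]; rewrite lee_fin ge0_ler_powR ?nnegrE ?(ltW D_gt0) ?(ltW c0)//.
  exact: ltW.
Qed.

End conformal_density.

(** * Invariance of [nu] under the diagonal action *)

Section diagonal_invariance.
Context {R : realType} {X : pmetricType R}.
Variable D : R.
Hypothesis X_perfect : isolated [set: X] = set0.
Hypothesis X_compact : compact [set: X].
Hypothesis D_gt0 : 0 < D.
Hypothesis X_regular : ahlfors_regular X D.
Local Open Scope ereal_scope.

(** Carries the sigma-finiteness that Tonelli's theorem asks for. *)
Let mu : {sigma_finite_measure set (borel X) -> \bar R} :=
  HB.pack (hausdorff_measure D) (Measure_isSigmaFinite.Build _ _ _
    (hausdorff_measure D) (hausdorff_measure_sigma_finite X_compact X_regular)).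

Let phi (g : moebius X) (x : borel X) : \bar R :=
  (metric_derivative g x `^ D)%:E.

Let mphi g : measurable_fun setT (phi g).
Proof. exact: measurable_conformal_density. Qed.

Let phi_ge0 g x : 0 <= phi g x. Proof. by rewrite lee_fin powR_ge0. Qed.

Lemma hausdorff_measure_integral_le (g : moebius X) (h : borel X -> \bar R) :
  measurable_fun setT h -> (forall x, 0 <= h x) ->
  \int[mu]_x h x <= \int[mu]_x (h (g x) * phi g x).
Proof.
apply: (@ge0_integral_le_density _ _ _ _ _ mu mu g) => //.
  exact: borel_measurable_moebius.
by move=> A mA; exact: hausdorff_measure_le_density.
Qed.

(** Tonelli reduces this to the one-variable inequality, used first in the second variable for fixed
    [x], then in [x] on the resulting inner integral. *)
Lemma product_hausdorff_integral_le (g : moebius X)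
    (H : borel X * borel X -> \bar R) :
  measurable_fun setT H -> (forall z, 0 <= H z) ->
  \int[mu \x mu]_z H z <=
  \int[mu \x mu]_z (H (moebius_diag g z) * (phi g z.1 * phi g z.2)).
Proof.
move=> mH H0.
have mg := @borel_measurable_moebius R X g.
(* The integrand after the change of the second variable alone. *)
pose K (z : borel X * borel X) := H (z.1, g z.2 : borel X) * phi g z.2.
have mK : measurable_fun setT K.
  apply: emeasurable_funM; last exact: (measurableT_comp (mphi g)).
  refine (measurableT_comp mH _); apply: measurable_fun_pair => //.
  by refine (measurableT_comp mg _).
have K0 z : 0 <= K z by rewrite mule_ge0.
have mHx x : measurable_fun setT (fun y => H (x, y)).
  exact: (measurableT_comp mH).
rewrite fubini_tonelli1//.
apply: (@le_trans _ _ (\int[mu]_x fubini_F mu K x)).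
  apply: ge0_le_integral => //.
  - by move=> x _; exact: integral_ge0.
  - exact: measurable_fun_fubini_tonelli_F.
  - exact: measurable_fun_fubini_tonelli_F.
  - by move=> x _; exact: (hausdorff_measure_integral_le g (mHx x)).
apply: le_trans (hausdorff_measure_integral_le g _ _) _.
- exact: measurable_fun_fubini_tonelli_F.
- by move=> x; exact: integral_ge0.
rewrite fubini_tonelli1//; last 2 first.
- apply: emeasurable_funM.
    by apply: (measurableT_comp mH); exact: measurable_moebius_diag.
  by apply: emeasurable_funM; exact: (measurableT_comp (mphi g)).
- by move=> z; rewrite !mule_ge0.
apply: ge0_le_integral => //.
- by move=> x _; rewrite mule_ge0//; exact: integral_ge0.
- apply: emeasurable_funM => //.
  apply: (measurableT_comp _ mg); exact: measurable_fun_fubini_tonelli_F.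
- apply: measurable_fun_fubini_tonelli_F.
    apply: emeasurable_funM.
      by apply: (measurableT_comp mH); exact: measurable_moebius_diag.
    by apply: emeasurable_funM; exact: (measurableT_comp (mphi g)).
  by move=> z; rewrite !mule_ge0.
move=> x _; rewrite /fubini_F -ge0_integralZr//.
- apply: ge0_le_integral => //.
  + by move=> y _; rewrite mule_ge0.
  + apply: emeasurable_funM => //; exact: (measurableT_comp mK).
  + apply: emeasurable_funM; last first.
      exact: (@emeasurable_funM _ _ _ _ (cst (phi g x)) (phi g)).
    by refine (measurableT_comp (mHx (g x)) _).
  + by move=> y _; rewrite /K/= -muleA (muleC (phi g y)).
- exact: (measurableT_comp mK).
Qed.

(** The defining identity of [|g'|], raised to the power [- D], produces exactly the inverse of the
    two conformal factors; hence the exponent [2 * D] in the density of [nu]. *)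
Lemma nu_density_moebius (g : moebius X) (x y : X) :
  (mdist (g x) (g y) `^ (- (2 * D)) *
   (metric_derivative g x `^ D * metric_derivative g y `^ D) =
   mdist x y `^ (- (2 * D)))%R.
Proof.
have f0 t := metric_derivative_gt0 X_perfect g t.
have E (a b : X) : (mdist a b `^ (- (2 * D)) = (mdist a b ^+ 2) `^ (- D))%R.
  by rewrite -mulrN powRrM powR_mulrn// mdist_ge0.
rewrite !E metric_derivativeE// powRM ?mulr_ge0 ?mdist_ge0 ?(ltW (f0 _))//.
rewrite -[X in (_ * X)%R]powRM ?(ltW (f0 _))// mulrAC powRN mulVf ?mul1r//.
by rewrite gt_eqF// powR_gt0// mulr_gt0.
Qed.

Let nu_le (g : moebius X) (A : set (borel X * borel X)) : measurable A ->
  nu D A <= nu D (moebius_diag g @^-1` A).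
Proof.
move=> mA; pose w z := (mdist (z.1 : X) (z.2 : X) `^ (- (2 * D)))%:E.
rewrite [leLHS](_ : _ = \int[mu \x mu]_z (w \_ A) z); last first.
  by rewrite -integral_mkcond.
rewrite [leRHS](_ : _ = \int[mu \x mu]_z
    (w \_ (moebius_diag g @^-1` A)) z); last first.
  by rewrite -integral_mkcond.
apply: le_trans (product_hausdorff_integral_le g _ _) _.
- apply/(measurable_restrictT _ mA); apply: measurable_funTS.
  exact: measurable_nu_density.
- by move=> z; apply: erestrict_ge0 => {}z _; rewrite lee_fin powR_ge0.
rewrite le_eqVlt; apply/orP; left; apply/eqP.
apply: eq_integral => z _; rewrite /restrict.
have -> : (z \in moebius_diag g @^-1` A) = (moebius_diag g z \in A).
  by apply/idP/idP; rewrite !inE.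
by case: ifPn => _; rewrite ?mul0e// /w /phi -!EFinM nu_density_moebius.
Qed.

(** The reverse inequality is [nu_le] for [g^-1] and the preimage of [A] under [g], whose preimage
    under [g^-1] is [A] again. *)
Lemma nu_moebius_diag (g : moebius X) (A : set (borel X * borel X)) :
  measurable A -> nu D (moebius_diag g @^-1` A) = nu D A.
Proof.
move=> mA; apply/eqP; rewrite eq_le nu_le// andbT.
have mgA : measurable (moebius_diag g @^-1` A).
  by rewrite -[X in measurable X]setTI; exact: measurable_moebius_diag.
apply: le_trans (nu_le (g^-1)%g mgA) _.
rewrite -comp_preimage (_ : _ \o _ = id)//.
by apply/funext => z /=; rewrite moebius_diagKV.
Qed.

Lemma ge0_integral_nu_moebius_diag (g : moebius X)
    (F : borel X * borel X -> \bar R) :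
  measurable_fun setT F -> (forall z, 0 <= F z) ->
  \int[nu_measure X_compact X_regular]_z F (moebius_diag g z) =
  \int[nu_measure X_compact X_regular]_z F z.
Proof.
move=> mF F0; have mg := measurable_moebius_diag g.
rewrite -[LHS](ge0_integral_pushforward mg
  (nu_measure X_compact X_regular) measurableT mF)//.
apply: eq_measure_integral => A mA _.
exact: nu_moebius_diag.
Qed.

End diagonal_invariance.

(** * Integrability of functions dominated by the distance *)

Lemma nneseries_geometric_lty (R : realType) (K r : R) : 0 <= K -> 0 < r < 1 ->
  (\sum_(k <oo) (K * r ^+ k)%:E < +oo)%E.
Proof.
move=> K0 /andP[r0 r1]; apply: (@le_lt_trans _ _ (K * (1 - r)^-1)%:E); last exact: ltry.
apply: lime_le.
  by apply: is_cvg_nneseries => k _ _; rewrite lee_fin mulr_ge0// exprn_ge0// ltW.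
near=> n; rewrite sumEFin lee_fin; apply: geometric_le_lim => //.
by rewrite gtr0_norm.
Unshelve. all: by end_near. Qed.

Section integrability.
Context {R : realType} {X : pmetricType R}.
Variable D : R.
Hypothesis X_perfect : isolated [set: X] = set0.
Hypothesis X_compact : compact [set: X].
Hypothesis D_gt0 : 0 < D.
Hypothesis X_regular : ahlfors_regular X D.
Local Open Scope ereal_scope.

Let mu : {sigma_finite_measure set (borel X) -> \bar R} :=
  HB.pack (hausdorff_measure D) (Measure_isSigmaFinite.Build _ _ _
    (hausdorff_measure D) (hausdorff_measure_sigma_finite X_compact X_regular)).

Let dist (z : borel X * borel X) : R := mdist (z.1 : X) (z.2 : X).

(** Regularity covers radii up to the diameter. A larger [r] exceeds the distance [d0] of two fixed
    distinct points, so the total mass [m] is at most [m / d0]^ D * r [^ D]. *)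
Lemma hausdorff_measure_ball_le : exists C : R, (0 < C)%R /\
  forall (x : X) r, (0 < r)%R -> hausdorff_measure D (ball x r) <= (C * r `^ D)%:E.
Proof.
have [c [C [c0 C0 reg]]] := X_regular.
have [q [q0]] := perfect_uniq3 X_perfect (point : X).
rewrite /= !inE !negb_or -!andbA => /and4P[pq _ _ _].
pose d0 := mdist point q.
have d00 : (0 < d0)%R by rewrite mdist_gt0.
have d0D : (0 < d0 `^ D)%R by exact: powR_gt0.
pose m := fine (hausdorff_measure D [set: borel X]).
have mE : m%:E = hausdorff_measure D [set: borel X].
  by rewrite fineK// ge0_fin_numE// hausdorff_measure_finite.
have m0 : (0 <= m)%R by rewrite fine_ge0.
exists (C + m / d0 `^ D)%R; split; first by rewrite ltr_wpDr// divr_ge0 ?(ltW d0D).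
move=> x r r0; have [rX|Xr] := leP r%:E (diam [set: X]).
  have /andP[_ h] := reg x r (ltW r0) rX; apply: le_trans h _.
  by rewrite lee_fin ler_wpM2r ?powR_ge0// lerDl divr_ge0 ?(ltW d0D).
apply: (@le_trans _ _ m%:E); first by rewrite mE; exact: le_hausdorff.
have d0r : (d0 <= r)%R.
  rewrite -lee_fin; apply: le_trans (ltW Xr); exact: le_diam.
rewrite lee_fin mulrDl ler_wpDl ?mulr_ge0 ?powR_ge0 ?(ltW C0)//.
rewrite mulrAC ler_pdivlMr// ler_wpM2l// ge0_ler_powR ?nnegrE ?(ltW D_gt0) ?(ltW r0) ?(ltW d00)//.
Qed.

Lemma measurable_dist_preimage (A : set R) : measurable A ->
  measurable (dist @^-1` A).
Proof.
by move=> mA; rewrite -[X in measurable X]setTI; exact: measurable_mdist.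
Qed.

(** Each slice of the set is a ball of radius [r]; integrating its measure over [x] multiplies the
    ball constant by the total mass. *)
Lemma product_hausdorff_dist_lt : exists C : R, (0 <= C)%R /\
  forall r, (0 < r)%R -> (mu \x mu) (dist @^-1` `]-oo, r[) <= (C * r `^ D)%:E.
Proof.
have [C [C0 Cball]] := hausdorff_measure_ball_le.
pose m := fine (hausdorff_measure D [set: borel X]).
have mE : m%:E = mu setT.
  by rewrite fineK// ge0_fin_numE// hausdorff_measure_finite.
have m0 : (0 <= m)%R by rewrite fine_ge0.
exists (C * m)%R; split; first by rewrite mulr_ge0// ltW.
move=> r r0; have mA := measurable_dist_preimage (measurable_itv `]-oo, r[).
apply: (@le_trans _ _ (\int[mu]_x (C * r `^ D)%:E)).
  apply: ge0_le_integral => //.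
  - exact: measurable_fun_xsection.
  - move=> x _; rewrite /= (_ : xsection _ x = ball (x : X) r); first exact: Cball.
    by apply/seteqP; split => y; rewrite /xsection/= inE/= /dist/= in_itv/= ballEmdist.
by rewrite integral_cst// -[X in _ * X <= _]/(mu setT) -mE -EFinM mulrAC.
Qed.

Lemma dist_bounded : exists M : R, (0 < M)%R /\ forall z, (dist z <= M)%R.
Proof.
have cd : {within [set: X], continuous (fun x => mdist x (point : X))}.
  by apply: continuous_subspaceT; exact: mdistl_continuous.
have X0 : [set: X] !=set0 by exists point.
have [b _ bM] := compact_EVT_max X0 X_compact cd.
exists (2 * mdist b point + 1)%R; split.
  by rewrite ltr_wpDl// mulr_ge0// mdist_ge0.
move=> [x y]; rewrite /dist/=.
have := metric_triangle (x : X) point y; have := bM x; have := bM y.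
rewrite !inE (metric_sym point y) => /(_ I) + /(_ I); lra.
Qed.

(* On the shell [e^(t-k-1) < dist <= e^(t-k)] the integrand is at most
   [L^p e^(p(t-k))] and [nu] has mass at most a constant times
   [e^(-2D(t-k-1)) e^(D(t-k+1))]; these products form a geometric series of
   ratio [e^(D-p)]. *)
Lemma nu_integral_powR_lty (F : borel X * borel X -> R) (L p : R) :
  measurable_fun setT F -> (0 < L)%R -> (D < p)%R ->
  (forall z, (`|F z| <= L * mdist (z.1 : X) (z.2 : X))%R) ->
  \int[nu_measure X_compact X_regular]_z (`|F z| `^ p)%:E < +oo.
Proof.
move=> mF L0 Dp FL.
have p0 : (0 < p)%R := lt_trans D_gt0 Dp.
have [C [C0 Cd]] := product_hausdorff_dist_lt.
have [M [M0 dM]] := dist_bounded.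
pose t := ln M.
have mdist_ : measurable_fun setT dist by exact: measurable_mdist.
pose u z := (t - ln (dist z))%R.
have mu_ : measurable_fun setT u.
  by apply: measurable_funB => //; exact: measurableT_comp.
(* As [ln 0 = 0], the condition on [u] alone could put the diagonal in a shell; positivity of [dist]
   excludes it. *)
pose E k := dist @^-1` `]0%R, +oo[ `&` u @^-1` `[k%:R, k.+1%:R[.
have mE k : measurable (E k).
  apply: measurableI; first exact: measurable_dist_preimage.
  by rewrite -[X in measurable X]setTI; exact: mu_.
have tE : trivIset setT E.
  apply/trivIsetP => i j _ _ ij; apply/seteqP; split => // z [[_ +] [_ +]].
  rewrite /= !in_itv/= => /truncn_def zi /truncn_def zj.
  by move: ij; rewrite -zi -zj eqxx.
have EE z : (0 < dist z)%R -> (\bigcup_k E k) z.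
  move=> z0; exists (Num.truncn (u z)) => //; split; rewrite /= in_itv/= ?z0//.
  by rewrite truncn_itv// subr_ge0 ler_ln ?posrE.
have mFp : measurable_fun setT (fun z => (`|F z| `^ p)%:E).
  apply/measurable_EFinP; apply: (measurableT_comp (measurable_powR _)).
  exact: measurableT_comp.
(* Outside the shells [dist] vanishes, hence so does [F]. *)
have -> : \int[nu_measure X_compact X_regular]_z (`|F z| `^ p)%:E =
    \int[nu_measure X_compact X_regular]_(z in \bigcup_k E k) (`|F z| `^ p)%:E.
  rewrite [RHS]integral_mkcond; apply: eq_integral => z _.
  rewrite /restrict; case: ifPn => // zE.
  have z0 : dist z = 0%R.
    apply/eqP; rewrite eq_le mdist_ge0 andbT leNgt; apply/negP => /EE.
    by move/mem_set; apply/negP.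
  have := FL z; rewrite -/(dist z) z0 mulr0 normr_le0 => /eqP ->.
  by rewrite normr0 powR0// gt_eqF.
rewrite ge0_integral_bigcup//; last first.
  by apply: measurable_funTS; exact: mFp.
(* The value at [k = 0] of the product [a * (b * (C * e))] bounding the integral over the [k]-th
   shell. *)
pose K := (L `^ p * C * expR (p * t - D * t + 3 * D))%R.
have K0 : (0 <= K)%R by rewrite !mulr_ge0 ?powR_ge0 ?expR_ge0.
apply: (@le_lt_trans _ _ (\sum_(k <oo) (K * expR (D - p) ^+ k)%:E)); last first.
  by apply: nneseries_geometric_lty => //; rewrite expR_gt0 expR_lt1 subr_lt0.
apply: lee_nneseries => [k _ _|k _].
  by apply: integral_ge0 => z _; rewrite lee_fin powR_ge0.
have Ek z : E k z -> (expR (t - k%:R - 1) <= dist z <= expR (t - k%:R))%R.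
  move=> [/=]; rewrite /u !in_itv/= andbT => z0 /andP[h1 h2].
  rewrite -[dist z]lnK ?posrE// !ler_expR.
  by move: h1 h2; rewrite -[k.+1%:R]natr1; lra.
pose a := ((L * expR (t - k%:R)) `^ p)%R.
pose b := (expR (t - k%:R - 1) `^ (- (2 * D)))%R.
(* The mass bound concerns the strict inequality [dist < r], while the shell contains points with
   [dist = expR (t - k%:R)]; hence the radius with exponent [+ 1]. *)
pose e := (expR (t - k%:R + 1) `^ D)%R.
have nuE : nu_measure X_compact X_regular (E k) <= (b * (C * e))%:E.
  apply: (@le_trans _ _ (\int[mu \x mu]_(z in E k) b%:E)).
    rewrite -[leLHS]/(\int[mu \x mu]_(z in E k) (dist z `^ (- (2 * D)))%:E).
    apply: ge0_le_integral => //.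
    - by move=> z _; rewrite lee_fin powR_ge0.
    - by apply: measurable_funTS; exact: measurable_nu_density.
    - move=> z Ez; have /andP[ez _] := Ek z Ez; rewrite lee_fin /b !powRN.
      have z0 : (0 < dist z)%R := lt_le_trans (expR_gt0 _) ez.
      rewrite lef_pV2 ?posrE ?powR_gt0 ?expR_gt0//.
      by rewrite ge0_ler_powR ?nnegrE ?expR_ge0 ?(ltW z0)// mulr_ge0// ltW.
  rewrite integral_cst// EFinM lee_wpmul2l ?lee_fin ?powR_ge0//.
  apply: le_trans (Cd _ (expR_gt0 _)); apply: le_measure; rewrite ?inE//.
    exact: measurable_dist_preimage.
  move=> z Ez; have /andP[_ zk] := Ek z Ez; rewrite /= in_itv/=; apply: le_lt_trans zk _.
  by rewrite ltr_expR ltrDl.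
apply: (@le_trans _ _ (\int[nu_measure X_compact X_regular]_(z in E k) a%:E)).
  apply: ge0_le_integral => //.
  - by apply: measurable_funTS; exact: mFp.
  - move=> z Ez; have /andP[_ zk] := Ek z Ez; rewrite lee_fin ge0_ler_powR ?nnegrE ?(ltW p0)//.
      by rewrite mulr_ge0 ?expR_ge0// ltW.
    by apply: le_trans (FL z) _; rewrite ler_wpM2l// ltW.
rewrite integral_cst//; apply: (@le_trans _ _ (a%:E * (b * (C * e))%:E)).
  by rewrite lee_wpmul2l ?lee_fin ?powR_ge0.
rewrite -EFinM lee_fin le_eqVlt; apply/orP; left; apply/eqP.
rewrite /a /b /e /K powRM ?expR_ge0 ?(ltW L0)// -powR_mulrn ?expR_ge0// -!expRM.
transitivity (L `^ p * C * (expR ((t - k%:R) * p) *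
  expR ((t - k%:R - 1) * - (2 * D)) * expR ((t - k%:R + 1) * D)))%R; first by ring.
by rewrite -[RHS]mulrA -!expRD; congr (_ * expR _)%R; ring.
Qed.

End integrability.

(** * The action on [L^p] and the cocycle *)

Section lfun_action.
Context {R : realType} {X : pmetricType R}.
Variables (D p : R).
Hypothesis X_perfect : isolated [set: X] = set0.
Hypothesis X_compact : compact [set: X].
Hypothesis D_gt0 : 0 < D.
Hypothesis X_regular : ahlfors_regular X D.
Hypothesis p_gt0 : 0 < p.

Let nu := nu_measure X_compact X_regular.

Lemma Lfun_nuP (F : borel X * borel X -> R) : (F \in Lfun nu p%:E) <->
  measurable_fun setT F /\ ('N[nu]_p%:E[EFin \o F] < +oo)%E.
Proof.
split=> [/andP[]|[mF nF]]; first by rewrite !inE.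
by apply/andP; rewrite !inE.
Qed.

Lemma measurable_moebius_act (g : moebius X) (F : borel X * borel X -> R) :
  measurable_fun setT F -> measurable_fun setT (moebius_act g F : borel X * borel X -> R).
Proof.
by move=> mF; exact: (measurableT_comp mF (measurable_moebius_diag (g^-1)%g)).
Qed.

Lemma Lnorm_moebius_act (g : moebius X) (F : borel X * borel X -> R) :
  measurable_fun setT F ->
  ('N[nu]_p%:E[EFin \o moebius_act g F] = 'N[nu]_p%:E[EFin \o F])%E.
Proof.
move=> mF; rewrite unlock /Lnorm; congr (_ `^ _)%E.
apply: (@ge0_integral_nu_moebius_diag _ _ _ X_perfect X_compact D_gt0
  X_regular (g^-1)%g (fun z => (`|(F z)%:E| `^ p)%E)) => [|z]; last exact: poweR_ge0.
apply/measurable_EFinP; apply: (measurableT_comp (measurable_powR _)).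
exact: measurableT_comp.
Qed.

(** Makes the action well defined on classes: invariance of [nu] keeps the preimage of an
    exceptional null set null. *)
Lemma moebius_act_ae_eq (g : moebius X) (F H : borel X * borel X -> R) :
  F = H %[ae nu] -> moebius_act g F = moebius_act g H %[ae nu].
Proof.
move=> [N [mN N0 FHN]]; exists (moebius_diag (g^-1)%g @^-1` N); split.
- by rewrite -[X in measurable X]setTI; exact: measurable_moebius_diag.
- exact: etrans (nu_moebius_diag X_perfect X_compact D_gt0 X_regular _ mN) N0.
- by move=> z /= nz; apply: FHN => /= FH; apply: nz => _; exact: FH.
Qed.

Lemma log_derivative_cocycle_measurable (g : moebius X) :
  measurable_fun setT (log_derivative_cocycle g : borel X * borel X -> R).
Proof.
have ml : measurable_fun [set: borel X]
    (fun x : borel X => ln (metric_derivative (g^-1)%g x)).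
  apply: (measurableT_comp (@measurable_ln R)).
  by apply: borel_measurable_continuous; exact: metric_derivative_continuous.
by apply: measurable_funB; exact: (measurableT_comp ml).
Qed.

Lemma log_derivative_cocycle_Lfun (g : moebius X) : D < p ->
  (log_derivative_cocycle g : borel X * borel X -> R) \in Lfun nu p%:E.
Proof.
move=> Dp; apply/Lfun_nuP; split; first exact: log_derivative_cocycle_measurable.
rewrite unlock /Lnorm; apply: poweR_lty.
have [L [L0 HL]] := ln_metric_derivative_lipschitz X_perfect X_compact (g^-1)%g.
(* [L] may be zero, so [L + 1] supplies a positive constant. *)
apply: (@nu_integral_powR_lty _ _ _ X_perfect X_compact D_gt0 X_regular
  (log_derivative_cocycle g) (L + 1)) => //.
- exact: log_derivative_cocycle_measurable.
- by rewrite ltr_wpDl.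
- by move=> z; apply: le_trans (HL _ _) _; rewrite ler_wpM2r ?mdist_ge0// lerDl.
Qed.

(** The logarithm of the chain rule for [h^-1 * g^-1], the inverse of [g * h]; it holds at every
    point. *)
Lemma log_derivative_cocycleM (g h : moebius X) :
  log_derivative_cocycle (g * h)%g =
  moebius_act g (log_derivative_cocycle h) \+ log_derivative_cocycle g.
Proof.
apply/funext => -[x y]; rewrite /log_derivative_cocycle /moebius_act invgM.
rewrite !metric_derivative_comp// !lnM ?posrE ?metric_derivative_gt0//.
by rewrite /=; ring.
Qed.

End lfun_action.

Theorem proposition5p5 (R : realType) (X : pmetricType R) (D p : R)
    (X_compact : compact [set: X])
    (X_perfect : isolated [set: X] = set0)
    (X_dim : hausdorff_dim [set: X] = D%:E) (D_gt0 : 0 < D)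
    (X_regular : ahlfors_regular X D)
    (p_ge1 : 1 <= p) (D_lt_p : D < p) :
  let nu := nu_measure X_compact X_regular in
  Lp_linear_isometric_action nu p%:E (@moebius_act R X) /\
  Lp_cocycle nu p%:E (@moebius_act R X) (@log_derivative_cocycle R X).
Proof.
move=> nu; have p_gt0 : 0 < p := lt_trans D_gt0 D_lt_p.
split; split.
- move=> g F /Lfun_nuP[mF nF]; apply/Lfun_nuP; split.
    exact: measurable_moebius_act.
  by rewrite Lnorm_moebius_act.
- by move=> g F H _ _; exact: moebius_act_ae_eq.
- split=> [F _|g h F _]; apply: aeW => z _; rewrite /moebius_act.
    by rewrite invg1; case: z.
  by rewrite invgM.
- by move=> g a F H _ _; exact: aeW.
- by move=> g F /Lfun_nuP[mF _]; exact: Lnorm_moebius_act.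
- by move=> g; exact: log_derivative_cocycle_Lfun.
- by move=> g h; apply: aeW => z _; rewrite log_derivative_cocycleM.
Qed.
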